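(* Let $k,c,m_1,m_2$ be non-negative integers with $m_1,m_2>c$. Then, the number $p^{(c)}_k(m_1,m_2)$ of tight planar maps with exactly two (labeled) faces of respective degrees $2m_1$ and $2m_2$, with $(k+1)$ among their vertices marked, one of them being distinguished, and with their unique cycle of length at least $2(c+1)$, is equal to $$p^{(c)}_k(m_1,m_2) = \sum_{\substack{k_1,k_2 \geq 0 \\ k_1+k_2=k}} p^{(c)}_{k_1}(m_1)\,q^{(c)}_{k_2}(m_2)$$ with $$q^{(c)}_{k_2}(m_2) = \binom{m_2+c}{k_2} \binom{m_2-c-1+k_2}{k_2} = \frac1{(k_2!)^2} \prod_{i=0}^{k_2-1} \left( m_2^2 - (c-i)^2 \right)$$ and $$p^{(c)}_{k_1}(m_1) := \binom{m_1-c-1}{k_1} \binom{m_1+c+k_1}{k_1} = \frac1{(k_1!)^2} \prod_{i=1}^{k_1} \left( m_1^2 - (c+i)^2 \right).$$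
   Context: A planar map is a connected multigraph (loops and multiple edges allowed) drawn on the sphere without edge crossings, considered up to orientation-preserving homeomorphism (preserving face labels, markings and the distinguished vertex). The degree of a face is its number of incident corners. A cycle is a simple closed path of non-zero length; a planar map with exactly two faces has a unique cycle. A map with some marked vertices is tight if every vertex of degree $1$ is marked. The distinguished vertex is one of the $k+1$ marked vertices. *)

(* Defs.v *)
From mathcomp Require Import all_boot all_order all_algebra all_fingroup.

Set Implicit Arguments.
Unset Strict Implicit.
Unset Printing Implicit Defensive.

(* A planar map, up to orientation-preserving homeomorphism, is encoded by its
   rotation system.  Darts are oriented edges: [alpha] reverses a dart and
   [sigma] turns to the next dart around its origin, so the cycles of [alpha],
   [sigma] are the edges and vertices, and those of [d |-> sigma (alpha d)] the
   faces.  Loops and multiple edges are allowed.  By the Euler relation the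
   surface is the sphere and there is at least one dart; the only planar map
   left out is the single vertex without edges, which has a single face. *)
Record planar_map := PlanarMap {
  dart : finType;
  alpha : {perm dart};
  sigma : {perm dart};
  alpha_invol : involutive alpha;
  alpha_nofix : forall d, alpha d != d;
  map_connected : forall d e,
    connect [rel x y | (y == alpha x) || (y == sigma x)] d e;
  map_euler :
    #|porbits sigma| + #|porbits (alpha * sigma)%g| = #|porbits alpha| + 2
}.

Definition vertices (M : planar_map) : {set {set dart M}} :=
  porbits (sigma M).

(* In the group of permutations, [(s * t) d = t (s d)]. *)
Definition faces (M : planar_map) : {set {set dart M}} :=
  porbits (alpha M * sigma M)%g.

Definition origin (M : planar_map) (d : dart M) : {set dart M} :=
  porbit (sigma M) d.

(* The condition on [alpha] only matters for [size s = 2]: it rules out going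
   back and forth along a single edge. *)
Definition is_cycle (M : planar_map) (s : seq (dart M)) : bool :=
  [&& 0 < size s,
      path.cycle (fun d e => origin (alpha M d) == origin e) s,
      uniq (map (@origin M) s)
    & all (fun d => alpha M d \notin s) s].

Record marked_map := MarkedMap {
  umap :> planar_map;
  face1 : {set dart umap};
  face2 : {set dart umap};
  marked : {set {set dart umap}};
  distinguished : {set dart umap};
  face1_neq_face2 : face1 != face2;
  facesE : faces umap = [set face1; face2];
  marked_vertices : marked \subset vertices umap;
  distinguished_marked : distinguished \in marked
}.

(* The degree of a vertex or face is its number of darts, i.e. of corners. *)
Definition tight (M : marked_map) : Prop :=
  forall v, v \in vertices M -> #|v| = 1 -> v \in marked M.

Definition isomorphic (M N : marked_map) : Prop :=
  exists h : dart M -> dart N,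
    [/\ bijective h,
        {morph h : d / alpha M d >-> alpha N d},
        {morph h : d / sigma M d >-> sigma N d},
        h @: face1 M = face1 N /\ h @: face2 M = face2 N
      & [set h @: (v : {set dart M}) | v in marked M] = marked N
        /\ h @: distinguished M = distinguished N].

(* The maps satisfying [P] form exactly [n] isomorphism classes. *)
Definition count_up_to_iso (P : marked_map -> Prop) (n : nat) : Prop :=
  exists f : 'I_n -> marked_map,
    [/\ forall i, P (f i),
        forall i j, isomorphic (f i) (f j) -> i = j
      & forall M, P M -> exists i, isomorphic M (f i)].

(* A map with exactly two faces has a single cycle, up to its starting point
   and direction, so the existential refers to that cycle. *)
Definition counted_map (c k m1 m2 : nat) (M : marked_map) : Prop :=
  [/\ tight M,
      #|face1 M| = 2 * m1,
      #|face2 M| = 2 * m2,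
      #|marked M| = k.+1
    & exists s : seq (dart M), is_cycle s /\ 2 * c.+1 <= size s].

Definition p1 (c k m : nat) : nat := 'C(m - c.+1, k) * 'C(m + c + k, k).

Definition q1 (c k m : nat) : nat := 'C(m + c, k) * 'C(m - c.+1 + k, k).

(* Main.v *)
(** Cutting along a cycle edge [r], the contours of the two faces, read from [r],
    give a linear order on the [2 m1 + 2 m2] darts for which the face permutation
    is fixed; by the Euler relation the edges then form a noncrossing matching,
    i.e. a Dyck path whose height at the junction of the two faces is the length
    [2 l] of the cycle.  The distinguished vertex singles out one cycle edge, namely
    the one at the foot of the tree carrying it, so every isomorphism class has
    exactly one such code.

    Such a code amounts to a pair of marked paths from height [2 l] to [0].  Let [F_h(n)] be the
    generating function, in the number of marked vertices, of forests of [h] trees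
    with [n] edges whose leaves are all marked, and [K_h(n)] its derivative divided
    by [h].  With [X] the marking variable, the codes with a cycle of length [2 l]
    are counted by the derivative of
    [(1 + X)^(2l) F_2l(m1 - l) F_2l(m2 - l)] divided by [2 l].  Since
    [F_(h+2)(n) + (1 + X) K_(h+2)(n) = K_h(n+1)], this is [T_(l-1) - T_l] where
    [T_l = (1 + X)^(2l+1) K_2l(m1 - l) K_2l(m2 - l)], and the sum over [l > c]
    telescopes to [T_c].  The coefficients of [K_2c(m - c)] and
    [(1 + X)^(2c+1) K_2c(m - c)] are the numbers [p] and [q]. *)

Require Import Defs.
From mathcomp Require Import all_boot all_order all_algebra all_fingroup.
From mathcomp Require Import zify ring.
Set Implicit Arguments.
Unset Strict Implicit.
Unset Printing Implicit Defensive.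

(** A planar map with two faces has as many vertices as edges, and a rooted noncrossing matching
    makes this concrete: each arc stands for the vertex directly under it. Marks thus become
    decorations of opening darts. An isomorphism that fixes the root is the identity, so once the
    distinguished vertex has chosen the root no automorphism has to be weighed. The division by
    [2 l] stands for a cyclic symmetry between the trees along the cycle, awkward to use on words.
    It is avoided: the distinguished mark is confined to the last descent, from height 1 to 0, and
    [F_h] and [K_h], given by their coefficients, are shown to obey the recursions that come from
    removing the first letter of a word. A subtracted term in these recursions discards the unmarked
    leaves. The openings of the [2 l] cycle arcs all belong to the first face, so the factor
    [(1 + X)^(2l)] comes from that face alone. *)

(** * Orbits of permutations *)

Section Porbits.
Variable T : finType.
Implicit Types (s b : {perm T}) (x y : T).

Lemma porbit_stable s x (P : pred T) :
  (forall y, P y -> P (s y)) -> P x -> {in porbit s x, forall y, P y}.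
Proof.
move=> stable Px y /porbitP[i ->]; rewrite permX.
by elim: i => [|i IHi] //=; apply: stable.
Qed.

Lemma porbit_const (A : eqType) s x (f : T -> A) :
  (forall y, f (s y) = f y) -> {in porbit s x, forall y, f y = f x}.
Proof.
move=> fs y /(porbit_stable (P := fun y => f y == f x)) H.
by apply/eqP/H => // z; rewrite fs.
Qed.

Lemma mem_porbit1 s x : s x \in porbit s x.
Proof. by rewrite -{1}(expg1 s) mem_porbit. Qed.

Lemma porbit_step s x : porbit s (s x) = porbit s x.
Proof. by apply/eqP; rewrite eq_porbit_mem mem_porbit1. Qed.

Lemma porbits_tperm_le s x y : #|porbits (tperm x y * s)| <= #|porbits s| + 1.
Proof.
by have /= := porbits_mul_tperm s x y; case: (x != y); case: (x \notin _); lia.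
Qed.

Definition moved b := [set x | b x != x].

(** The transposition of [x] and [b x] is one of the disjoint transpositions that make up [b], and
    multiplying by it deletes it. An involution can thus be peeled off pair by pair. *)
Lemma moved_mul_tperm b x : involutive b -> b x != x ->
  let b' := (b * tperm x (b x))%g in
  [/\ forall y, b' y = if (y == x) || (y == b x) then y else b y,
      involutive b', moved b' = moved b :\ x :\ b x & b = (tperm x (b x) * b')%g].
Proof.
move=> bK bx /=.
have E y : (b * tperm x (b x))%g y = if (y == x) || (y == b x) then y else b y.
  rewrite permM; case: tpermP => [e|e|n1 n2].
  - by rewrite -e bK eqxx orbT -(bK y) e.
  - by move/perm_inj: e => ->; rewrite eqxx.
  - by case: ifP => // /orP[] /eqP e; subst y; rewrite ?bK in n1 n2.
split=> // [y|| ].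
- rewrite !E; case: (boolP ((y == x) || (y == b x))) => [->//|/norP[n1 n2]].
  by rewrite (inv_eq bK) (negPf n2) (inj_eq perm_inj) (negPf n1) /= bK.
- apply/setP=> y; rewrite !inE E; case: ifP => [/orP[]/eqP->|/norP[-> ->]//].
    by rewrite eqxx andbF.
  by rewrite eqxx.
apply/permP=> y; rewrite permM E.
by case: tpermP => [->|->|/eqP/negPf-> /eqP/negPf->]; rewrite ?eqxx ?orbT ?bK.
Qed.

(** Each of the [#|moved b| / 2] transpositions of [b] creates at most one new cycle; doubling
    avoids the division. *)
Lemma porbits_mul_involution_le b s : involutive b ->
  2 * #|porbits (b * s)| <= 2 * #|porbits s| + #|moved b|.
Proof.
have [n] := ubnP #|moved b|; elim: n => // n IHn in b s *.
rewrite ltnS => le_n bK; have [e|[x]] := set_0Vmem (moved b).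
  have -> : b = 1%g.
    apply/permP=> y; rewrite perm1; apply/eqP/negPn/negP => yb.
    have : y \in moved b by rewrite inE.
    by rewrite e inE.
  by rewrite mul1g leq_addr.
rewrite inE => bx; have [E b'K mE bE] := moved_mul_tperm bK bx.
have cm : #|moved b| = (#|moved (b * tperm x (b x))|).+2.
  rewrite mE (cardsD1 x (moved b)) inE bx (cardsD1 (b x)) !inE bx.
  by rewrite (inj_eq perm_inj) bx.
have : #|moved (b * tperm x (b x))| < n by lia.
move/IHn/(_ b'K) => /(_ s).
have -> : (b * s = tperm x (b x) * (b * tperm x (b x) * s))%g.
  by rewrite [in RHS]mulgA -bE.
have := porbits_tperm_le ((b * tperm x (b x)) * s) x (b x); lia.
Qed.

Lemma card_porbits_involution b : involutive b -> (forall x, b x != x) ->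
  2 * #|porbits b| = #|T|.
Proof.
move=> bK bx; rewrite -cardsT mulnC.
have P x : porbit b x = [set x; b x].
  apply/eqP; rewrite eqEsubset; apply/andP; split; apply/subsetP => y; last first.
    by case/set2P => ->; rewrite ?porbit_id ?mem_porbit1.
  apply: (porbit_stable (P := mem [set x; b x])) => [z|] /=.
    by case/set2P => ->; rewrite ?bK !inE eqxx ?orbT.
  by rewrite !inE eqxx.
symmetry; apply: card_uniform_partition => [_ /imsetP[x _ ->]|].
  by rewrite P cards2 eq_sym bx.
apply/and3P; split.
- rewrite eqEsubset subsetT; apply/subsetP=> x _; apply/bigcupP.
  by exists (porbit b x); rewrite ?imset_f ?porbit_id.
- apply/trivIsetP=> _ _ /imsetP[x _ ->] /imsetP[y _ ->] ne.
  apply/pred0P => z /=; apply: contraNF ne => /andP[zx zy].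
  move: zx zy; rewrite -!eq_porbit_mem => /eqP<- /eqP<- //.
- by apply/negP=> /imsetP[x _ e]; move: (porbit_id b x); rewrite -e inE.
Qed.

End Porbits.

Lemma porbit_morph (T1 T2 : finType) (s1 : {perm T1}) (s2 : {perm T2}) (h : T1 -> T2) :
  {morph h : x / s1 x >-> s2 x} -> forall x, h @: porbit s1 x = porbit s2 (h x).
Proof.
move=> hM x; have hX i y : h ((s1 ^+ i)%g y) = (s2 ^+ i)%g (h y).
  by rewrite !permX; elim: i => //= i <-; rewrite hM.
apply/setP=> y; apply/imsetP/porbitP => [[z /porbitP[i ->] ->]|[i ->]].
  by exists i; rewrite hX.
by exists ((s1 ^+ i)%g x); rewrite ?mem_porbit // hX.
Qed.

Lemma porbits_morph (T1 T2 : finType) (s1 : {perm T1}) (s2 : {perm T2}) (h : T1 -> T2) :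
  bijective h -> {morph h : x / s1 x >-> s2 x} ->
  [set h @: (v : {set T1}) | v in porbits s1] = porbits s2.
Proof.
move=> [g gK hK] hM; apply/setP=> v; apply/imsetP/imsetP.
  by case=> _ /imsetP[x _ ->] ->; exists (h x) => //; apply: porbit_morph.
case=> x _ ->; exists (porbit s1 (g x)); first exact: imset_f.
by rewrite (porbit_morph hM) hK.
Qed.

Lemma card_porbits_morph (T1 T2 : finType) (s1 : {perm T1}) (s2 : {perm T2}) (h : T1 -> T2) :
  bijective h -> {morph h : x / s1 x >-> s2 x} -> #|porbits s1| = #|porbits s2|.
Proof.
move=> hb hM; rewrite -(porbits_morph hb hM) card_imset //.
exact/imset_inj/bij_inj.
Qed.

(** * Noncrossing matchings *)

Section Matchings.
Variables a' b' : nat.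
Local Notation a := a'.+1.
Local Notation N := (a' + b').+2.
Implicit Types (i j d x y : 'I_N) (al : {perm 'I_N}).

Definition rot_fun (i : nat) : nat :=
  if i == a' then 0 else if i == (a' + b').+1 then a else i.+1.

Lemma rot_fun_lt i : rot_fun i < N.
Proof. by rewrite /rot_fun; have := ltn_ord i; repeat (case: ifP => /=); lia. Qed.

Lemma rot_fun_inj : injective (fun i : 'I_N => Ordinal (rot_fun_lt i)).
Proof.
move=> i j /(congr1 val) /=; rewrite /rot_fun => e; apply: val_inj => /=.
by move: e; have := ltn_ord i; have := ltn_ord j; repeat (case: ifP => /=); lia.
Qed.

Definition face_rot : {perm 'I_N} := perm rot_fun_inj.

Lemma face_rotE i : face_rot i = rot_fun i :> nat. Proof. by rewrite permE. Qed.

Lemma face_rot0 i : i = a' :> nat -> face_rot i = ord0.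
Proof. by move=> e; apply: val_inj; rewrite /= face_rotE /rot_fun e eqxx. Qed.

Lemma face_rotS i : i <> a' :> nat -> i <> ord_max -> face_rot i = i.+1 :> nat.
Proof.
move=> n1 n2; rewrite face_rotE /rot_fun; case: eqP => //= _; case: eqP => // e.
by case: n2; apply: val_inj.
Qed.

Lemma face_rot_max : face_rot ord_max = a :> nat.
Proof. by rewrite face_rotE /rot_fun /= eqxx; case: eqP => //; lia. Qed.

Lemma face_rot_lt i : (face_rot i < a) = (i < a).
Proof. by rewrite face_rotE /rot_fun; have := ltn_ord i; repeat (case: ifP => /=); lia. Qed.

(** Darts [0] and [N - 1] carry the root edge, which lies on the cycle. Only the right ends of two
    overlapping arcs are compared; involutivity gives the left ends, see [nc_gt]. *)
Definition noncrossing al :=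
  [&& al ord0 == ord_max, [forall i, al (al i) == i], [forall i, al i != i]
    & [forall i : 'I_N, forall j : 'I_N, (i < j) && (j < al i) ==> (al j < al i)]].

Definition up al i := i < al i.

(* The darts of the first face lying on the cycle. *)
Definition trunk al : {set 'I_N} := [set i : 'I_N | (i < a) && (a <= al i)].

(* The arc opened at [d] passes over the corner that precedes [x]. *)
Definition covers al d (x : nat) := (d < x) && (x <= al d).

(* The corners [0] and [a] belong to the same vertex, at the base of the trunk. *)
Definition corner (x : nat) := if x == 0 then a else x.

Definition parent al x : 'I_N :=
  [arg max_(d > ord0 | covers al d (corner x)) (d : nat)].

Definition trunk_of al x : 'I_N :=
  [arg max_(d > ord0 | (d \in trunk al) && covers al d (corner x)) (d : nat)].

Section Noncrossing.
Variable al : {perm 'I_N}.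
Hypothesis nc : noncrossing al.
Local Notation sg := (al * face_rot)%g.

Lemma nc0 : al ord0 = ord_max. Proof. by case/and4P: nc => /eqP. Qed.
Lemma ncK : involutive al.
Proof. by case/and4P: nc => _ /forallP H _ _ i; apply/eqP. Qed.
Lemma nc_max : al ord_max = ord0. Proof. by rewrite -nc0 ncK. Qed.
Lemma nc_neq i : al i <> i :> nat.
Proof. by move/val_inj; apply/eqP; case/and4P: nc => _ _ /forallP. Qed.
Lemma nc_inj i j : al i = al j :> nat -> i = j.
Proof. by move/val_inj/perm_inj. Qed.
Lemma nc_lt i j : i < j -> j < al i -> al j < al i.
Proof.
move=> h1 h2; case/and4P: nc => _ _ _ /forallP/(_ i)/forallP/(_ j)/implyP.
by apply; rewrite h1.
Qed.
Lemma nc_gt i j : i < j -> j < al i -> i < al j.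
Proof.
move=> h1 h2; have := @nc_neq j; have := nc_lt h1 h2.
case: (ltngtP i (al j)) => // [h _ _|/val_inj h _ _].
  by have := @nc_lt (al j) i h; rewrite ncK; lia.
by move: h2; rewrite h ncK ltnn.
Qed.

Lemma sgE x : sg x = face_rot (al x). Proof. by rewrite permM. Qed.

Lemma nc_gt0 i : i <> ord0 -> 0 < i.
Proof. by rewrite lt0n => n0; apply/eqP => e; apply: n0; apply: val_inj. Qed.

Lemma nc_nmax i : i <> ord_max -> i < (a' + b').+1.
Proof.
have := ltn_ord i; rewrite ltnS leq_eqVlt => /orP[/eqP e n|//].
by case: n; apply: val_inj.
Qed.

Lemma corner_bound i : 0 < corner i < N.
Proof. by rewrite /corner; have := ltn_ord i; case: eqP; lia. Qed.

Lemma covers_corner0 i : covers al ord0 (corner i).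
Proof. by rewrite /covers nc0 /=; have := corner_bound i; lia. Qed.

Lemma trunk0 : ord0 \in trunk al.
Proof. by rewrite inE nc0 /=; lia. Qed.

Lemma trunk_neq d d' : d \in trunk al -> d' \in trunk al -> d <> al d'.
Proof. by rewrite !inE => h1 h2 e; move: h1; rewrite e ncK; lia. Qed.

Lemma corner_rot_up y : y < al y -> corner (face_rot y) = y.+1.
Proof.
move=> uy; rewrite /corner; have [e|ne] := eqVneq (y : nat) a'; first by rewrite face_rot0 //= e.
rewrite face_rotS //; first by apply/eqP.
by move=> e; move: uy; rewrite e nc_max.
Qed.

Lemma corner_rot_down y : al y < y -> y <> ord_max -> corner (face_rot y) = y.+1.
Proof.
move=> uy nm; rewrite /corner; have [e|ne] := eqVneq (y : nat) a'; first by rewrite face_rot0 //= e.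
by rewrite face_rotS //; apply/eqP.
Qed.

(** The corners after [y] and before [al y] are at the two feet of the arc of [y], on the same side
    of it: just under it if [y] opens it, just outside if [y] closes it. Any other arc covers both
    or neither. At [ord_max] the convention on [corner] makes them equal. *)
Lemma covers_face_rot d y : covers al d (corner (face_rot y)) = covers al d (corner (al y)).
Proof.
have [->|/eqP nm] := eqVneq y ord_max.
  rewrite nc_max /corner face_rot_max //.
have [uy|dy|/val_inj e] := ltngtP y (al y); last by case: (@nc_neq y); rewrite -e.
  rewrite corner_rot_up // /corner; have -> : (al y == 0 :> nat) = false by lia.
  rewrite /covers; have [->|ne] := eqVneq d y; first by lia.
  have [->|ne2] := eqVneq d (al y); first by rewrite ncK; lia.
  have n1 : al d <> y :> nat by move=> e; rewrite -(val_inj e) ncK eqxx in ne2.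
  have n2 : al d <> al y :> nat by move/nc_inj => e; rewrite e eqxx in ne.
  have n3 : d <> y :> nat by move/val_inj => e; rewrite e eqxx in ne.
  have := @nc_lt y d; have := @nc_lt d y; have := @nc_gt y d; lia.
rewrite corner_rot_down //.
have n0 : 0 < al y.
  by apply: nc_gt0 => e; apply: nm; rewrite -nc0 -e ncK.
rewrite /corner; have -> : (al y == 0 :> nat) = false by lia.
rewrite /covers; have [->|ne] := eqVneq d y; first by lia.
have [->|ne2] := eqVneq d (al y); first by rewrite ncK; lia.
have n1 : al d <> y :> nat by move=> e; rewrite -(val_inj e) ncK eqxx in ne2.
have n2 : al d <> al y :> nat by move/nc_inj => e; rewrite e eqxx in ne.
have n3 : d <> y :> nat by move/val_inj => e; rewrite e eqxx in ne.
have n4 : d <> al y :> nat by move/val_inj => e; rewrite e eqxx in ne2.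
have := @nc_lt (al y) d; have := @nc_gt (al y) d; rewrite ncK.
have := @nc_lt d (al y); have := @nc_gt d (al y); rewrite ncK; lia.
Qed.

Lemma covers_sg d x : covers al d (corner (sg x)) = covers al d (corner x).
Proof. by rewrite sgE covers_face_rot ncK. Qed.

Lemma parent_sg x : parent al (sg x) = parent al x.
Proof.
rewrite /parent; congr (odflt _ _); apply: eq_pick => d /=.
by rewrite covers_sg; congr andb; apply: eq_forallb => d'; rewrite covers_sg.
Qed.

Lemma trunk_of_sg x : trunk_of al (sg x) = trunk_of al x.
Proof.
rewrite /trunk_of; congr (odflt _ _); apply: eq_pick => d /=.
by rewrite covers_sg; congr andb; apply: eq_forallb => d'; rewrite covers_sg.
Qed.

Lemma parentP x (p := parent al x) :
  covers al p (corner x) /\ forall d, covers al d (corner x) -> d <= p.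
Proof.
by rewrite /p /parent; case: arg_maxnP => [|d h1 h2]; rewrite ?covers_corner0.
Qed.

Lemma parent_uniq x p : covers al p (corner x) ->
  (forall d, covers al d (corner x) -> d <= p) -> parent al x = p.
Proof.
move=> h1 h2; have [h3 h4] := parentP x; apply: val_inj; apply/eqP.
by rewrite eqn_leq h2 // h4.
Qed.

Lemma trunk_ofP x (p := trunk_of al x) :
  [/\ p \in trunk al, covers al p (corner x)
    & forall d, d \in trunk al -> covers al d (corner x) -> d <= p].
Proof.
rewrite /p /trunk_of; case: arg_maxnP => [|d /andP[h1 h2] h3].
  by rewrite covers_corner0 trunk0.
by split=> // d' h4 h5; apply: h3; rewrite h4.
Qed.

Lemma trunk_of_uniq x p : p \in trunk al -> covers al p (corner x) ->
  (forall d, d \in trunk al -> covers al d (corner x) -> d <= p) -> trunk_of al x = p.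
Proof.
move=> h0 h1 h2; have [h5 h3 h4] := trunk_ofP x; apply: val_inj; apply/eqP.
by rewrite eqn_leq h2 // h4.
Qed.

Lemma parent_al i : up al i -> parent al (al i) = i.
Proof.
rewrite /up => ui; have c : corner (al i) = al i by rewrite /corner; case: eqP => //; lia.
apply: parent_uniq; rewrite c; first by rewrite /covers; lia.
move=> d; rewrite /covers leqNgt => h; apply/negP => h'.
by have := @nc_lt i d; lia.
Qed.

Lemma trunk_up d : d \in trunk al -> up al d.
Proof. by rewrite inE /up; lia. Qed.

Lemma parent_up x : up al (parent al x).
Proof. by have [] := parentP x; rewrite /covers /up; lia. Qed.

Lemma trunk_of_al d : d \in trunk al -> trunk_of al (al d) = d.
Proof.
move=> hd; have ud := trunk_up hd.
have c : corner (al d) = al d by rewrite /corner; case: eqP => //; move: ud; rewrite /up; lia.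
apply: trunk_of_uniq => //; rewrite c; first by rewrite /covers; move: ud; rewrite /up; lia.
move=> d' _; rewrite /covers leqNgt => h; apply/negP => h'.
by have := @nc_lt d d'; lia.
Qed.

(* Off the cycle, both ends of an edge hang from the same point of the trunk. *)
Lemma trunk_of_tree x : x \notin trunk al -> al x \notin trunk al ->
  trunk_of al (al x) = trunk_of al x.
Proof.
wlog ux : x / x < al x => [th|] n1 n2.
  have [u|u|u] := ltngtP x (al x); first exact: th.
    by have := th (al x); rewrite ncK => ->.
  by case: (@nc_neq x).
rewrite /trunk_of; congr (odflt _ _).
have x0 : 0 < x by apply: nc_gt0 => e; move: n1; rewrite e trunk0.
have E d : (d \in trunk al) && covers al d (corner (al x)) =
           (d \in trunk al) && covers al d (corner x).
  have [hd|//] := boolP (d \in trunk al); rewrite /=.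
  have -> : corner (al x) = al x by rewrite /corner; case: eqP => //; lia.
  have -> : corner x = x by rewrite /corner; case: eqP => //; lia.
  have m1 : d <> x :> nat by move/val_inj => e; move: n1; rewrite -e hd.
  have m2 : al d <> x :> nat by move/val_inj => e; move: n2; rewrite -e ncK hd.
  have m3 : al d <> al x :> nat by move/nc_inj => e; move: n1; rewrite -e hd.
  rewrite /covers; move: hd n1 n2; rewrite !inE ncK.
  have := @nc_lt x d; have := @nc_lt d x; have := @nc_gt x d; have := @nc_gt d x.
  have := @nc_gt x (al d); rewrite ncK; lia.
by apply: eq_pick => d /=; rewrite E; congr andb; apply: eq_forallb => d'; rewrite E.
Qed.

Lemma parent_porbit x y : x \in porbit sg y -> parent al x = parent al y.
Proof. by move/(porbit_const parent_sg). Qed.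

Lemma trunk_of_porbit x y : x \in porbit sg y -> trunk_of al x = trunk_of al y.
Proof. by move/(porbit_const trunk_of_sg). Qed.

Lemma face_rot_pred x : exists2 y : 'I_N, face_rot y = x &
  [\/ y = ord_max /\ x = a :> nat, x = ord0 /\ y = a' :> nat | x = y.+1 :> nat].
Proof.
exists ((face_rot^-1)%g x); first by rewrite permKV.
set y := (face_rot^-1)%g x; have e : face_rot y = x by rewrite permKV.
have := face_rotE y; rewrite e /rot_fun; case: eqP => [h1 h2|h1].
  by constructor 2; split=> //; apply: val_inj.
case: eqP => [h2 h3|h2 h3]; last by constructor 3.
by constructor 1; split=> //; apply: val_inj.
Qed.

(** Go backwards along the contour from [x]: skip an arc that has just been closed, stop at one that
    has just been opened, which is the innermost arc over the corner. *)
Lemma mem_porbit_parent x : x \in porbit sg (al (parent al x)).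
Proof.
(* Position in the contour, doubled to make room for dart [0]: its corner is that of [a], so it is
   ranked just before [a]. *)
pose mu (x : 'I_N) := if x == 0 :> nat then 2 * a' + 1 else 2 * x.
have [n] := ubnP (mu x); elim: n => // n IHn in x *; rewrite ltnS => le_n.
have [y yx hy] := face_rot_pred x.
have sy : sg (al y) = x by rewrite sgE ncK.
have IH : mu (al y) < mu x -> x \in porbit sg (al (parent al x)).
  move=> lt; have := IHn (al y) (leq_trans lt le_n).
  by rewrite -sy parent_sg -!eq_porbit_mem porbit_step.
have [uy|dy|/val_inj e] := ltngtP y (al y); last by case: (@nc_neq y); rewrite -e.
  rewrite -sy parent_sg parent_al //.
  by rewrite mem_porbit1.
have n0 : y <> ord_max -> 0 < al y.
  by move=> ny; apply: nc_gt0 => e; apply: ny; rewrite -nc0 -e ncK.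
apply: IH; rewrite /mu; clear -hy dy n0 nc.
case: hy => [[ey ex]|[ex ey]|ex].
- by rewrite ey nc_max ex /=; lia.
- have ny : y <> ord_max by move=> e; move: ey; rewrite e /=; lia.
  by have := n0 ny; rewrite ex /=; case: eqP; lia.
- have ny : y <> ord_max by move=> e; move: (ltn_ord x); rewrite ex e /=; lia.
  by have := n0 ny; rewrite ex /=; case: eqP; lia.
Qed.

End Noncrossing.
End Matchings.

(** * The planar map carried by a noncrossing matching *)

Section MatchingMaps.
Variables a' b' : nat.
Local Notation a := a'.+1.
Local Notation N := (a' + b').+2.
Local Notation face_rot := (@face_rot a' b').
Implicit Types (i j d x y : 'I_N) (al : {perm 'I_N}).

Definition lower : {set 'I_N} := [set i : 'I_N | i < a].

Lemma connect_rot (e : rel 'I_N) : (forall x, connect e x (face_rot x)) ->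
  forall x y, (x < a) = (y < a) -> connect e x y.
Proof.
move=> er.
have step i j : (i : nat) <= j -> (i < a) = (j < a) -> connect e i j.
  have [n] := ubnP (j - i); elim: n => // n IHn in i *; rewrite ltnS => le_n ij s.
  have [->|ne] := eqVneq i j; first exact: connect0.
  have ne' : i <> j :> nat by move/val_inj => h; rewrite h eqxx in ne.
  have h : face_rot i = i.+1 :> nat.
    apply: face_rotS => [h|h]; first by have := ltn_ord j; lia.
    by have := ltn_ord j; move: ij ne'; rewrite h /=; lia.
  by apply: connect_trans (er i) _; apply: IHn; rewrite h; lia.
have loop i j : (i < a) = (j < a) -> (j : nat) <= i -> connect e i j.
  move=> s ji; have [ia|ia] := boolP (i < a).
    have aN : a' < N by lia.
    apply: connect_trans (step i (Ordinal aN) _ _) _; rewrite /= ?ltnS //; first by lia.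
    apply: connect_trans (er _) _; rewrite face_rot0 //.
    by apply: step; rewrite /= -?s // ia.
  apply: connect_trans (step i ord_max _ _) _ => /=; first by have := ltn_ord i; lia.
    by lia.
  by apply: connect_trans (er _) _; apply: step; rewrite face_rot_max; lia.
by move=> x y s; have [h|h] := leqP x y; [apply: step | apply: loop => //; apply: ltnW].
Qed.

Lemma porbit_face_rot x : porbit face_rot x = if x < a then lower else ~: lower.
Proof.
have -> : (if x < a then lower else ~: lower) = [set y : 'I_N | (y < a) == (x < a)].
  by apply/setP => y; case: ifP => h; rewrite !inE; case: (y < a).
apply/setP=> y; rewrite inE; apply/idP/eqP => [|s].
  by move/(porbit_const (f := fun y : 'I_N => y < a)) => -> // z; rewrite face_rot_lt.
pose e := [rel x y | y \in porbit face_rot x].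
have : connect e x y.
  by apply: connect_rot => [z|//]; apply: connect1; rewrite /= mem_porbit1.
case/connectP => p pth ->; elim: p x pth {s} => [|z p IHp] x /=; first by rewrite porbit_id.
by case/andP; rewrite -eq_porbit_mem => /eqP<- /IHp.
Qed.

Lemma lower0 : ord0 \in lower. Proof. by rewrite inE. Qed.
Lemma porbits_face_rot : porbits face_rot = [set lower; ~: lower].
Proof.
apply/setP=> v; rewrite !inE; apply/imsetP/orP => [[x _ ->]|].
  by rewrite porbit_face_rot; case: ifP; rewrite eqxx; [left | right].
by case=> /eqP->; [exists ord0 | exists ord_max] => //; rewrite porbit_face_rot //=; case: ltnP => //; lia.
Qed.

Lemma lower_neqC : lower != ~: lower.
Proof. by apply/eqP => /setP/(_ ord0); rewrite in_setC lower0. Qed.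

Lemma card_lower : #|lower| = a.
Proof.
have h : a <= N by lia.
have inj : injective (widen_ord h) by move=> u v /(congr1 val) /= /val_inj.
rewrite -[RHS](card_ord a) -(card_imset _ inj).
apply: eq_card => x; rewrite inE; apply/idP/imsetP => [xa|[y _ ->]]; last exact: (ltn_ord y).
by exists (Ordinal xa) => //; apply: val_inj.
Qed.

Lemma card_lowerC : #|~: lower| = b'.+1.
Proof. by rewrite cardsCs setCK card_ord card_lower; lia. Qed.

Section Noncrossing.
Variable al : {perm 'I_N}.
Hypothesis nc : noncrossing al.
Local Notation sg := (al * face_rot)%g.

Definition ups : {set 'I_N} := [set i | up al i].

(** [al i] is at the right foot of the arc [i], on its inner side, so this is the vertex directly
    under that arc; [parent] is the inverse correspondence. *)
Definition vertex_of i := porbit sg (al i).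

Lemma vertex_of_inj : {in ups &, injective vertex_of}.
Proof.
move=> i j; rewrite !inE => ui uj e.
have : al i \in porbit sg (al j) by rewrite -[porbit _ _]e porbit_id.
by move/(parent_porbit nc); rewrite !parent_al.
Qed.

Lemma vertex_of_parent x : vertex_of (parent al x) = porbit sg x.
Proof. by apply/esym/eqP; rewrite eq_porbit_mem mem_porbit_parent. Qed.

Lemma porbits_sg : porbits sg = vertex_of @: ups.
Proof.
apply/setP=> v; apply/imsetP/imsetP => [[x _ ->]|[i _ ->]]; last by exists (al i).
by exists (parent al x); rewrite ?inE ?parent_up ?vertex_of_parent.
Qed.

Lemma card_ups : 2 * #|ups| = N.
Proof.
have e : ~: ups = al @: ups.
  apply/setP=> i; rewrite !inE /up; apply/idP/imsetP => [h|[j]].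
    exists (al i); rewrite ?inE /up ncK //.
    by have := @nc_neq _ _ _ nc i; lia.
  by rewrite inE /up => h ->; rewrite ncK //; lia.
have : #|~: ups| = #|ups| by rewrite e card_imset //; apply: perm_inj.
have := cardsC ups; rewrite card_ord; lia.
Qed.

Lemma card_porbits_sg : 2 * #|porbits sg| = N.
Proof. by rewrite porbits_sg card_in_imset ?card_ups //; apply: vertex_of_inj. Qed.

Lemma al_neq x : al x != x.
Proof. by apply/eqP => e; case: (@nc_neq _ _ _ nc x); rewrite e. Qed.

Lemma al_sg : (al * sg)%g = face_rot.
Proof. by apply/permP=> x; rewrite !permM (ncK nc). Qed.

Lemma nc_euler : #|porbits sg| + #|porbits (al * sg)%g| = #|porbits al| + 2.
Proof.
rewrite al_sg porbits_face_rot cards2 lower_neqC /=.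
have := card_porbits_involution (ncK nc) al_neq; have := card_porbits_sg.
by rewrite card_ord; set A := #|_|; set B := #|porbits al|; lia.
Qed.

Lemma nc_connected x y : connect [rel x y | (y == al x) || (y == sg x)] x y.
Proof.
set e := rel_of_simpl _.
have ea z : connect e z (al z) by apply: connect1; rewrite /e /= eqxx.
have er z : connect e z (face_rot z).
  by apply: connect_trans (ea z) _; apply: connect1; rewrite /e /= permM (ncK nc) eqxx orbT.
have [s|s] := eqVneq (x < a) (y < a); first exact: connect_rot.
pose z := if x < a then ord0 else ord_max : 'I_N.
apply: (connect_trans (y := z)).
  by apply: connect_rot => //; rewrite /z; case: ifP => //=; lia.
apply: connect_trans (ea z) _; apply: connect_rot => //; move: s; rewrite /z.
by case: (x < a); rewrite ?(nc0 nc) ?(nc_max nc) /=; case: (ltnP y a) => //; lia.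
Qed.

Definition same_side x := (x < a) == (al x < a).

Lemma same_sideE x : same_side x = (x \notin trunk al) && (al x \notin trunk al).
Proof. by rewrite /same_side !inE (ncK nc); lia. Qed.

(** Connection that never uses an edge of the cycle; its classes are the trees planted on the cycle
    vertices. *)
Definition hang : rel 'I_N :=
  [rel x y | (y == sg x) || ((y == al x) && same_side x)].

Lemma trunk_of_hang x y : connect hang x y -> trunk_of al y = trunk_of al x.
Proof.
case/connectP => p pth ->; elim: p x pth => [|z p IHp] x //= /andP[h /IHp->].
case/orP: h => [/eqP->|/andP[/eqP->]]; first by rewrite trunk_of_sg.
by rewrite same_sideE => /andP[h1 h2]; rewrite trunk_of_tree.
Qed.

Lemma connect_porbit (e : rel 'I_N) x y : (forall z, e z (sg z)) ->
  y \in porbit sg x -> connect e x y.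
Proof.
move=> es /porbitP[i ->]; elim: i => [|i IHi]; first by rewrite expg0 perm1 connect0.
by apply: connect_trans IHi (connect1 _); rewrite expgSr [in X in e _ X]permM.
Qed.

(** Climb from [x] to the arc over it; if that arc is off the cycle, cross its edge to the vertex
    outside and repeat from there, at a smaller corner. *)
Lemma connect_trunk_of x : connect hang (al (trunk_of al x)) x.
Proof.
have [n] := ubnP (corner a' x); elim: n => // n IHn in x *; rewrite ltnS => le_n.
set p := parent al x.
have cp : connect hang (al p) x.
  by apply: connect_porbit (mem_porbit_parent nc x) => z; rewrite /hang /= eqxx.
have [cov mx] := parentP nc x.
have [hp|hp] := boolP (p \in trunk al).
  rewrite (_ : trunk_of al x = p) //; apply: trunk_of_uniq => // d _; exact: mx.
have up_p : up al p := parent_up nc x.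
have hp' : al p \notin trunk al by rewrite inE (ncK nc); move: up_p; rewrite /up; lia.
have -> : trunk_of al x = trunk_of al p.
  rewrite -(trunk_of_tree nc hp hp'); apply: trunk_of_porbit => //; exact: mem_porbit_parent.
have p0 : 0 < p by apply: nc_gt0 => e; move: hp; rewrite e (trunk0 nc).
apply: connect_trans (IHn p _) _.
  apply: leq_trans le_n; rewrite {1}/corner; case: eqP => [|_]; first by lia.
  by case/andP: cov.
apply: connect_trans (connect1 _) cp.
by rewrite /hang /= eqxx same_sideE hp hp' orbT.
Qed.

Local Notation next_edge := (fun x y => porbit sg (al x) == porbit sg y).

(** An edge off the trunk is a bridge: being under its arc is a property of vertices that changes
    along this edge only. A cycle runs through the edge once, hence could not return to its starting
    point. *)
Lemma cycle_on_trunk s x : path.cycle next_edge s -> uniq s ->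
  all (fun y => al y \notin s) s -> x \in s -> ~~ same_side x.
Proof.
move=> cyc us /allP ns xs; apply/negP => ss.
pose i := if x < al x then x else al x.
have ix : i = x \/ i = al x by rewrite /i; case: ifP; [left|right].
have ui : i < al i by rewrite /i; case: ifP; rewrite ?(ncK nc) //; have := @nc_neq _ _ _ nc x; lia.
have si : same_side i by case: ix => ->; rewrite // /same_side (ncK nc) eq_sym.
have nti : i \notin trunk al by move: si; rewrite same_sideE => /andP[].
have i0 : 0 < i by apply: nc_gt0 => e; move: nti; rewrite e (trunk0 nc).
pose b y := covers al i (corner a' y).
have bE y z : porbit sg y == porbit sg z -> b z = b y.
  move/eqP => e; apply: (porbit_const (s := sg)); last by rewrite e porbit_id.
  by move=> t; rewrite /b covers_sg.
have b0 : b ord0 = false by move: nti; rewrite /b /covers /corner inE /=; lia.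
have bE' y : 0 < y -> b y = (i < y <= al i) by rewrite /b /covers /corner; case: eqP => //; lia.
have bmax : b ord_max = false.
  rewrite bE' //=; apply/negP => /andP[_ h].
  have : al i = ord_max by apply: val_inj => /=; have := ltn_ord (al i); lia.
  by rewrite -(nc0 nc) => /perm_inj e; move: i0; rewrite e.
have bal y : y <> i -> y <> al i -> b (al y) = b y.
  move=> n1 n2.
  have [->|n3] := eqVneq y ord0; first by rewrite (nc0 nc) b0.
  have [->|n4] := eqVneq y ord_max; first by rewrite (nc_max nc) b0.
  have y0 : 0 < y by apply/nc_gt0/eqP.
  have y1 : 0 < al y by apply: nc_gt0 => e; move: n4; rewrite -(nc0 nc) -e (ncK nc) eqxx.
  rewrite !bE' //.
  have m1 : y <> i :> nat by move/val_inj.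
  have m2 : y <> al i :> nat by move/val_inj.
  have m3 : al y <> al i :> nat by move/val_inj/perm_inj.
  have m4 : al y <> i :> nat by move/val_inj => e; apply: n2; rewrite -e (ncK nc).
  have := @nc_lt _ _ _ nc i y; have := @nc_gt _ _ _ nc i y.
  have := @nc_lt _ _ _ nc i (al y); have := @nc_gt _ _ _ nc i (al y); rewrite (ncK nc).
  clear -y0 y1 m1 m2 m3 m4; lia.
have bx : b (al x) = ~~ b x.
  have b1 : b i = false by rewrite bE' // ltnn.
  have b2 : b (al i) = true by rewrite bE' ?ui ?leqnn ?(ltn_trans i0 ui).
  case: ix => e; first by rewrite -e b1 b2.
  by rewrite -(ncK nc x) -e b2 (ncK nc) b1.
case/rot_to: xs => k p rp.
have up : uniq (x :: p) by rewrite -rp rot_uniq.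
have cp : path next_edge x (rcons p x) by rewrite -[path _ _ _]/(path.cycle _ (x :: p)) -rp rot_cycle.
have hp y : y \in p -> y <> i /\ y <> al i.
  move=> yp; have n1 : y <> x by move=> e; move: up; rewrite /= -e yp.
  have sm z : (z \in s) = (z \in x :: p) by rewrite -rp mem_rot.
  have n2 : y <> al x.
    move=> e; have := ns x; rewrite !sm mem_head -e inE yp orbT => /(_ isT) //.
  by case: ix => ->; rewrite ?(ncK nc).
have key q y0 : b (al y0) = ~~ b x -> path next_edge y0 (rcons q x) ->
    (forall y, y \in q -> y <> i /\ y <> al i) -> False.
  elim: q y0 => [|z q IHq] y0 h /=.
    by rewrite andbT => /bE e _; move: h; rewrite -e; case: (b x).
  case/andP=> /bE e pth hq; apply: (IHq z) => // [|y yq]; last by apply: hq; rewrite inE yq orbT.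
  by have [n1 n2] := hq z (mem_head _ _); rewrite bal // e.
exact: key bx cp hp.
Qed.

(** Replacing each dart of a cycle by the dart of its edge in the first face lands in the trunk, and
    is injective because no edge is run through in both directions. *)
Lemma cycle_size_le s : path.cycle next_edge s -> uniq s ->
  all (fun y => al y \notin s) s -> size s <= #|trunk al|.
Proof.
move=> cyc us ns; pose f x := if x \in trunk al then x else al x.
have ft x : x \in s -> f x \in trunk al.
  by move/(cycle_on_trunk cyc us ns); rewrite same_sideE negb_and !negbK /f; case: ifP.
have fi : {in s &, injective f}.
  have fc x : f x = x \/ f x = al x by rewrite /f; case: ifP; [left|right].
  have h x y : x \in s -> y \in s -> x <> al y.
    by move=> xs ys e; have /allP/(_ y ys) := ns; rewrite -e xs.
  move=> x y xs ys; case: (fc x) (fc y) => -> [] ->; try exact: perm_inj.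
  - by [].
  - by move=> e; case: (h x y).
  - by move=> e; case: (h y x).
have <- : #|[seq f x | x in s]| = size s by rewrite card_in_image //; apply/card_uniqP.
apply: subset_leq_card; apply/subsetP => _ /imageP[x xs ->]; exact: ft.
Qed.

End Noncrossing.
End MatchingMaps.

(** * The trunk as a cycle of the map *)

Section TrunkCycle.
Variables a' b' : nat.
Local Notation a := a'.+1.
Local Notation N := (a' + b').+2.
Local Notation face_rot := (@face_rot a' b').
Implicit Types (i j d x y : 'I_N).

Section Noncrossing.
Variable al : {perm 'I_N}.
Hypothesis nc : noncrossing al.
Local Notation sg := (al * face_rot)%g.
Local Notation next_edge := (fun x y => porbit sg (al x) == porbit sg y).

(** An arc over the corner of a trunk dart must reach beyond the junction, so it is a trunk arc
    itself. *)
Lemma parent_trunk d p : d \in trunk al -> p \in trunk al -> covers al p (corner a' d) ->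
  (forall d', d' \in trunk al -> covers al d' (corner a' d) -> d' <= p) -> parent al d = p.
Proof.
move=> hd hp cp mx; apply: parent_uniq => // d' cd'; apply: mx => //.
move: cd'; rewrite /covers /corner; case: eqP => [_|_]; first by rewrite inE ltnS.
have [e|ne] := eqVneq (al d') d; first by move: hd; rewrite -e !inE (ncK nc); lia.
have {}ne : al d' <> d :> nat by move/val_inj => e; rewrite e eqxx in ne.
by move: hd; rewrite !inE; have := @nc_lt _ _ _ nc d' d; lia.
Qed.

Lemma sorted_enum_trunk : sorted (fun x y => x < y) (enum (trunk al)).
Proof.
have : sorted ltn (map val (enum (trunk al))); last by rewrite sorted_map.
apply: (subseq_sorted ltn_trans (s2 := map val (enum 'I_N))).
  by apply: map_subseq; rewrite /enum_mem; apply: subseq_trans (filter_subseq _ _) _; rewrite filter_predT.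
by rewrite val_enum_ord iota_ltn_sorted.
Qed.

(** The trunk arcs are nested, so each lies just outside the next one. The loop closes because the
    corner of dart [0] is that of the junction, under the last trunk arc. *)
Lemma next_trunk d : d \in trunk al -> parent al (next (enum (trunk al)) d) = d.
Proof.
set s := enum _ => dD; have ds : d \in s by rewrite mem_enum.
have srt := sorted_enum_trunk; rewrite -/s in srt.
have tr : transitive (fun x y : 'I_N => x < y) by move=> ? ? ?; apply: ltn_trans.
pose t := index d s; have ts : t < size s by rewrite index_mem.
have dE : nth ord0 s t = d by rewrite nth_index.
have mem_nth' u : u < size s -> nth ord0 s u \in trunk al.
  by move=> us; rewrite -mem_enum mem_nth.
have idx x : x \in trunk al -> exists2 u, u < size s & nth ord0 s u = x.
  by rewrite -mem_enum => xs; exists (index x s); rewrite ?index_mem ?nth_index.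
have mono u v : u < size s -> v < size s -> (nth ord0 s u < nth ord0 s v) = (u < v).
  move=> us vs; apply/idP/idP => [|uv]; last exact: (sorted_ltn_nth tr ord0 srt).
  apply: contraTT; rewrite -!leqNgt leq_eqVlt => /orP[/eqP-> //|vu].
  by apply/ltnW/(sorted_ltn_nth tr ord0 srt).
have nE : next s d = if t.+1 < size s then nth ord0 s t.+1 else ord0.
  have [u us e0] := idx _ (trunk0 nc).
  have u0 : u = 0.
    case: u us e0 => // u us e0; have := mono 0 u.+1; rewrite e0 us ltn0 => H.
    by have := H (leq_ltn_trans (leq0n _) us) isT.
  rewrite next_nth ds -/t; rewrite u0 in e0.
  have G q : t < size q -> (if q is y :: p then nth y p t else d) =
      if t.+1 < size q then nth ord0 q t.+1 else nth ord0 q 0.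
    case: q => //= y p _; rewrite ltnS; case: ifP => h; first exact: set_nth_default.
    by rewrite nth_default // leqNgt h.
  by rewrite G // e0.
rewrite nE; case: ifP => h.
  have up1 := mono t t.+1 ts h; rewrite ltnSn dE in up1.
  have tD := mem_nth' _ h; set y := nth ord0 s t.+1 in up1 tD *.
  have cy : corner a' y = y by rewrite /corner; case: eqP => //; lia.
  apply: parent_trunk => //; rewrite cy.
    by move: dD tD; rewrite /covers !inE; lia.
  move=> d' /idx[u us <-] /andP[lt _].
  by rewrite mono // in lt; rewrite -dE leqNgt mono // -leqNgt -ltnS.
apply: parent_trunk => //; first exact: trunk0.
  by move: dD; rewrite /covers /corner !inE /=.
move=> d' /idx[u us <-] _; rewrite -dE leqNgt mono // -leqNgt -ltnS.
by apply: leq_trans us _; rewrite leqNgt h.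
Qed.

Lemma trunk_cycle (s := enum (trunk al)) :
  [/\ path.cycle next_edge s, uniq (map (porbit sg) s) & all (fun y => al y \notin s) s].
Proof.
have us : uniq s := enum_uniq _; split.
- apply: cycle_from_next => // x; rewrite mem_enum => xD.
  by rewrite -[porbit _ (next _ _)](vertex_of_parent nc) next_trunk.
- rewrite map_inj_in_uniq // => x y xs ys e.
  have {}e : parent al x = parent al y by apply: parent_porbit => //; rewrite -e porbit_id.
  have E z : z \in s -> parent al z = prev s z.
    rewrite -(mem_prev s) mem_enum => /next_trunk.
    by rewrite -/s (next_prev us).
  by rewrite (E x) // (E y) // in e; apply: (can_inj (next_prev us)).
apply/allP => x; rewrite mem_enum => xD; rewrite mem_enum.
by apply/negP => /(trunk_neq nc xD) []; rewrite (ncK nc).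
Qed.

End Noncrossing.
End TrunkCycle.

(** * The Euler relation excludes crossings *)

Section EulerRelation.
Variables a' b' : nat.
Local Notation a := a'.+1.
Local Notation N := (a' + b').+2.
Local Notation face_rot := (@face_rot a' b').
Implicit Types (i j d x y : 'I_N) (al : {perm 'I_N}).

(* The edge [{0, N - 1}] joins the two faces; the Euler relation leaves no room
   for a second edge joining two distinct cycles, as a crossing would. *)
Lemma euler_noncrossing al : involutive al -> (forall x, al x != x) ->
  al ord0 = ord_max -> 2 * #|porbits (al * face_rot)| = N -> noncrossing al.
Proof.
move=> alK alx al0 euler; apply/and4P; split.
- by rewrite al0.
- by apply/forallP => x; rewrite alK.
- by apply/forallP => x; apply: alx.
apply/forallP=> i; apply/forallP=> j; apply/implyP=> /andP[ij jai].
rewrite ltnNge; apply/negP => aij0.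
have aij : al i < al j.
  rewrite ltn_neqAle aij0 andbT; apply/eqP => /val_inj/perm_inj e.
  by move: ij; rewrite e ltnn.
have al_max : al ord_max = ord0 by rewrite -al0 alK.
have i0 : i != ord0 by apply/eqP=> e; move: aij (ltn_ord (al j)); rewrite e al0 /=; lia.
have i1 : i != ord_max by apply/eqP=> e; move: ij (ltn_ord j); rewrite e /=; lia.
have j0 : j != ord0 by apply/eqP=> e; move: ij; rewrite e.
have j1 : j != ord_max by apply/eqP=> e; move: jai (ltn_ord (al i)); rewrite e /=; lia.
have ji : j != i by apply/eqP=> e; move: ij; rewrite e ltnn.
have jai' : j != al i by apply/eqP=> e; move: jai; rewrite -e ltnn.
have al00 : al ord0 != ord0 := alx _.
have := moved_mul_tperm alK al00; rewrite al0; set b1 := (al * _)%g => -[E1 b1K m1 _].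
have b1i : b1 i = al i by rewrite E1 (negPf i0) (negPf i1).
have b1j : b1 j = al j by rewrite E1 (negPf j0) (negPf j1).
have := moved_mul_tperm b1K (x := i); rewrite b1i => /(_ (alx i)).
set b2 := (b1 * _)%g => -[E2 b2K m2 _].
have b2j : b2 j = al j by rewrite E2 (negPf ji) (negPf jai').
have := moved_mul_tperm b2K (x := j); rewrite b2j => /(_ (alx j)).
set b3 := (b2 * _)%g => -[E3 b3K m3 _].
(* [b3] is [al] without the arcs of [0], [i] and [j], six darts in all. *)
have cm : #|moved b3| + 6 = N.
  have c0 : #|moved al| = N.
    rewrite -[RHS](card_ord N); apply: eq_card => x.
    by rewrite !inE alx.
  have e2 : b2 (al j) = j by rewrite -b2j b2K.
  have e1 : b1 (al i) = i by rewrite -b1i b1K.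
  have n0 : ord_max != ord0 :> 'I_N by rewrite -al0.
  have ni : al i != i := alx i.
  have nj : al j != j := alx j.
  have := cardsD1 ord0 (moved al); have := cardsD1 ord_max (moved al :\ ord0).
  have := cardsD1 i (moved b1); have := cardsD1 (al i) (moved b1 :\ i).
  have := cardsD1 j (moved b2); have := cardsD1 (al j) (moved b2 :\ j).
  rewrite -m1 -m2 -m3 c0 !inE b2j b1i e1 e2 al_max al0 n0 ni nj.
  rewrite [i == _]eq_sym ni [j == _]eq_sym nj /=.
  move=> h1 h2 h3 h4 h5 h6; apply: esym (etrans h6 _).
  by rewrite h5 h4 h3 h2 h1 !addnA addnC.
(* The three arcs are put back one by one on [face_rot], which has two cycles: the first merges
   them, the second gives at most two, and the third, crossing the second, merges again. *)
pose ps0 := (tperm ord0 ord_max * face_rot)%g.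
pose ps1 := (tperm i (al i) * ps0)%g.
pose ps2 := (tperm j (al j) * ps1)%g.
have alE : (al * face_rot = b3 * ps2)%g.
  have tK (s r : {perm 'I_N}) x y : ((s * tperm x y) * (tperm x y * r) = s * r)%g.
    by rewrite mulgA -(mulgA s) tperm2 mulg1.
  by rewrite /ps2 /b3 tK /ps1 /b2 tK /ps0 /b1 tK.
have h0 : #|porbits ps0| = 1.
  have := porbits_mul_tperm face_rot ord0 ord_max; rewrite /= -/ps0 porbits_face_rot cards2 lower_neqC.
  rewrite porbit_face_rot /=; case: ifP => [|_]; first by lia.
  by rewrite !inE /=; set A := #|porbits ps0|; lia.
have h1 : #|porbits ps1| <= 2.
  by have := porbits_tperm_le ps0 i (al i); rewrite h0.
have h2 : #|porbits ps2| <= 1.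
  have := porbits_mul_tperm ps1 j (al j); rewrite /= -/ps2 [j == _]eq_sym alx porbit_sym.
  suff -> : al j \notin porbit ps1 j.
    by move: h1; rewrite /=; set B := #|porbits ps1|; set A := #|porbits ps2|; lia.
  (* [ps0] is a single cycle in which [0] sits between [a'] and [a]. [A] is the stretch of it from
     [i] excluded to [al i] included: stable under [ps1], it contains [j] but not [al j]. *)
  clear -ij jai aij al0 al_max i0 i1 j0 j1; pose A x := if x == ord0 then (i < a) && (a <= al i) else (i < x <= al i).
  apply/negP => /(porbit_stable (P := A)) H.
  suff /H : forall y, A y -> A (ps1 y).
    rewrite /A (negPf j0) => /(_ (introT andP (conj ij (ltnW jai)))).
    case: eqP => [e|_]; last by lia.
    by move: aij; rewrite e.
  have key z : z != ord_max -> i <= z < al i -> (z == ord0) = (i == ord0) -> A (face_rot z).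
    move=> /eqP zm iz _; rewrite /A; have [ez|nz] := eqVneq (z : nat) a'.
      by rewrite face_rot0 //=; lia.
    have e : face_rot z = z.+1 :> nat by apply: face_rotS => //; apply/eqP.
    by case: eqP => [h|_]; [move: e; rewrite h | rewrite e; lia].
  move=> y; rewrite /ps1 /ps0 !permM; case: (tpermP i (al i) y) => [->|->|n2 n3].
  - by rewrite /A (negPf i0) ltnn.
  - rewrite tpermD 1?eq_sym // => _; apply: key => //; lia.
  case: tpermP => [->|->|n4 n5].
  - rewrite /A eqxx => h; case: eqP => [e|_]; last by rewrite face_rot_max.
    by move: (@face_rot_max a' b'); rewrite e.
  - rewrite /A; case: eqP => //= _; have := ltn_ord (al j); lia.
  rewrite {1}/A; case: eqP => // _ h; apply: key => //; first exact/eqP.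
    have : y <> al i :> nat by move/val_inj.
    by lia.
  by rewrite (negPf i0); apply/eqP.
(* The other [(N - 6) / 2] arcs add at most one cycle each, which leaves fewer than [N / 2]. *)
have := porbits_mul_involution_le ps2 b3K; rewrite -alE euler; move: cm h2.
set A := #|moved b3|; set B := #|porbits ps2|; lia.
Qed.
End EulerRelation.

(** * Codes of marked maps *)

Implicit Types M N P : marked_map.

Definition isomorphism (M N : marked_map) (h : dart M -> dart N) :=
  [/\ bijective h,
      {morph h : d / alpha M d >-> alpha N d},
      {morph h : d / sigma M d >-> sigma N d},
      h @: face1 M = face1 N /\ h @: face2 M = face2 N
    & [set h @: (v : {set dart M}) | v in marked M] = marked N
      /\ h @: distinguished M = distinguished N].

Lemma imset_can (T1 T2 : finType) (h : T1 -> T2) (g : T2 -> T1) (v : {set T1}) :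
  cancel h g -> g @: (h @: v) = v.
Proof. by move=> hK; rewrite -imset_comp (eq_imset _ hK) imset_id. Qed.

Lemma isomorphism_inv M N (h : dart M -> dart N) g : cancel h g -> cancel g h ->
  isomorphism h -> isomorphism g.
Proof.
move=> hK gK [hb ha hs [h1 h2] [h3 h4]]; split.
- by exists h.
- by move=> x; apply: (can_inj hK); rewrite ha !gK.
- by move=> x; apply: (can_inj hK); rewrite hs !gK.
- by rewrite -h1 -h2 !imset_can.
rewrite -h3 -h4 imset_can // -imset_comp; split=> //.
by rewrite (eq_imset _ (g := id)) ?imset_id // => v /=; rewrite imset_can.
Qed.

Lemma isomorphism_comp M N P (h : dart M -> dart N) (g : dart N -> dart P) :
  isomorphism h -> isomorphism g -> isomorphism (g \o h).
Proof.
move=> [hb ha hs [h1 h2] [h3 h4]] [gb ga gs [g1 g2] [g3 g4]]; split.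
- exact: bij_comp.
- by move=> x /=; rewrite ha ga.
- by move=> x /=; rewrite hs gs.
- by rewrite !(imset_comp g h) h1 h2.
split; last by rewrite (imset_comp g h) h4.
rewrite -g3 -h3 -[RHS]imset_comp; apply: eq_imset => v /=.
by rewrite (imset_comp g h).
Qed.

Lemma isomorphic_sym M N : isomorphic M N -> isomorphic N M.
Proof.
move=> [h hi]; have [[g hK gK] _ _ _ _] := hi.
by exists g; apply: isomorphism_inv hK gK hi.
Qed.

Lemma isomorphism_vertices M N (h : dart M -> dart N) : isomorphism h ->
  [set h @: (v : {set dart M}) | v in vertices M] = vertices N.
Proof. by move=> [hb _ hs _ _]; apply: porbits_morph. Qed.

Lemma counted_map_iso c k m1 m2 M N : isomorphic M N ->
  counted_map c k m1 m2 M -> counted_map c k m1 m2 N.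
Proof.
move=> [h hi] [t f1 f2 mk [s [sc ss]]]; have [hb ha hs [h1 h2] [h3 h4]] := hi.
have hinj := bij_inj hb; have iinj := imset_inj hinj; split.
- move=> v; rewrite -(isomorphism_vertices hi) => /imsetP[w wM ->].
  by rewrite card_imset // => /(t _ wM) wm; rewrite -h3; apply: imset_f.
- by rewrite -h1 card_imset.
- by rewrite -h2 card_imset.
- by rewrite -h3 card_imset.
exists (map h s); rewrite size_map; split=> //.
have hO d : origin (h d) = h @: origin d by rewrite /origin (porbit_morph hs).
case/and4P: sc => s0 sc su sn; apply/and4P; split; rewrite ?size_map //.
- rewrite cycle_map; apply: sub_cycle sc => x y /= /eqP e.
  by rewrite -ha !hO e.
- rewrite -map_comp (eq_map (g := fun d => h @: origin d)) //.
  by rewrite (map_comp (fun v : {set dart M} => h @: v)) map_inj_uniq.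
rewrite all_map; apply: sub_all sn => x /=.
by rewrite -ha mem_map.
Qed.

Section Codes.
Variables a' b' : nat.
Local Notation a := a'.+1.
Local Notation N := (a' + b').+2.
Local Notation face_rot := (@face_rot a' b').
Implicit Types (i j d : 'I_N).

(* A matching, the marked vertices and the distinguished one; a vertex is
   designated by the opening dart [i] such that [vertex_of al i] is it. *)
Definition code : finType := ({perm 'I_N} * {set 'I_N} * 'I_N)%type.
Implicit Type x : code.

Definition precode x :=
  [&& noncrossing x.1.1, x.1.2 \subset ups x.1.1 & x.2 \in x.1.2].

Definition nc_map (al : {perm 'I_N}) (nc : noncrossing al) : planar_map :=
  PlanarMap (ncK nc) (al_neq nc) (nc_connected nc) (nc_euler nc).

Section CodeMap.
Variable x : code.
Hypothesis px : precode x.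
Local Notation al := x.1.1.

Lemma pre_nc : noncrossing al. Proof. by case/and3P: px. Qed.
Let nc := pre_nc.
Lemma pre_up i : i \in x.1.2 -> up al i.
Proof. by case/and3P: px => _ /subsetP S _ /S; rewrite inE. Qed.
Lemma pre_mem : x.2 \in x.1.2. Proof. by case/and3P: px. Qed.

Lemma faces_nc_map : faces (nc_map nc) = [set lower a' b'; ~: lower a' b'].
Proof. by rewrite /faces -porbits_face_rot; congr porbits; apply: al_sg. Qed.

Lemma marked_nc_map : [set vertex_of al i | i in x.1.2] \subset vertices (nc_map nc).
Proof.
have -> : vertices (nc_map nc) = [set vertex_of al i | i in ups al] by apply: porbits_sg.
by apply: imsetS; case/and3P: px.
Qed.

Lemma distinguished_nc_map : vertex_of al x.2 \in [set vertex_of al i | i in x.1.2].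
Proof. exact/imset_f/pre_mem. Qed.

Definition code_map : marked_map :=
  @MarkedMap (nc_map nc) _ _ _ _ (lower_neqC a' b') faces_nc_map marked_nc_map
    distinguished_nc_map.

(** The vertex under the arc [i] has degree 1 iff [sg] fixes [al i], that is, iff [al i] directly
    follows [i] in its face. *)
Definition tight_code := [forall i, up al i && (face_rot i == al i) ==> (i \in x.1.2)].

Lemma card_porbit1 (T : finType) (s : {perm T}) z : (#|porbit s z| == 1) = (s z == z).
Proof.
apply/idP/eqP => [/cards1P[y e]|e].
  by have := porbit_id s z; have := mem_porbit1 s z; rewrite e !inE => /eqP-> /eqP.
apply/cards1P; exists z; apply/setP=> y; rewrite inE; apply/idP/eqP => [|->]; last exact: porbit_id.
by move/(porbit_stable (P := fun y => y == z)) => H; apply/eqP/H => // t /eqP->; apply/eqP.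
Qed.

Lemma tight_codeP : tight code_map <-> tight_code.
Proof.
have V : vertices code_map = [set vertex_of al i | i in ups al] by apply: porbits_sg.
have E i : up al i -> (vertex_of al i \in marked code_map) = (i \in x.1.2).
  move=> ui; apply/imsetP/idP => [[j jS]|iS]; last by exists i.
  by move/(vertex_of_inj nc) => ->; rewrite ?inE // pre_up.
have D i : (#|vertex_of al i| == 1) = (face_rot i == al i).
  by rewrite card_porbit1 permM (ncK nc).
split=> [t|/forallP t].
  apply/forallP=> i; apply/implyP=> /andP[ui fi]; rewrite -E //.
  by apply: t; [rewrite V imset_f ?inE | apply/eqP; rewrite D].
move=> v; rewrite V => /imsetP[i]; rewrite inE => ui -> /eqP; rewrite D => fi.
by rewrite E //; apply: (implyP (t i)); rewrite ui.
Qed.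

(** The trunk is itself a cycle and no cycle is longer, so the existential on cycles becomes a bound
    on the trunk. *)
Lemma counted_codeP c k m1 m2 : a = 2 * m1 -> b'.+1 = 2 * m2 ->
  counted_map c k m1 m2 code_map <->
  [/\ tight_code, #|x.1.2| = k.+1 & 2 * c.+1 <= #|trunk al| ].
Proof.
move=> ea eb; have mk : #|marked code_map| = #|x.1.2|.
  by rewrite card_in_imset // => i j /pre_up ui /pre_up uj; apply: (vertex_of_inj nc); rewrite inE.
split=> [[t _ _ m [s [sc ss]]]|[t m L]].
  split; [exact/tight_codeP | by rewrite -mk | apply: leq_trans ss _].
  case/and4P: sc => _ cyc /map_uniq us ns.
  exact: (cycle_size_le nc).
split.
- exact/tight_codeP.
- by rewrite card_lower.
- by rewrite card_lowerC.
- by rewrite mk.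
have [h1 h2 h3] := trunk_cycle nc; exists (enum (trunk al)); rewrite -cardE; split=> //.
by apply/and4P; split=> //; rewrite -cardE; apply: leq_trans L.
Qed.

End CodeMap.

Section Morphism.
Variables (x y : code) (px : precode x) (py : precode y) (h : 'I_N -> 'I_N).
Hypothesis hi : @isomorphism (code_map px) (code_map py) h.
Local Notation al := x.1.1.
Local Notation be := y.1.1.

Lemma morph_al i : h (al i) = be (h i). Proof. by case: hi => _ /(_ i). Qed.
Lemma morph_sg i : h ((al * face_rot)%g i) = (be * face_rot)%g (h i).
Proof. by case: hi => _ _ /(_ i). Qed.
Lemma morph_face_rot i : h (face_rot i) = face_rot (h i).
Proof. by rewrite -[in LHS](ncK (pre_nc px) i) -sgE morph_sg sgE morph_al (ncK (pre_nc py)). Qed.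
Lemma morph_lower i : (h i < a) = (i < a).
Proof.
case: hi => hb _ _ [/setP/(_ (h i)) h1 _] _.
by move: h1; rewrite (mem_imset _ _ (bij_inj hb)) !inE.
Qed.
Lemma morph_trunk i : (h i \in trunk be) = (i \in trunk al).
Proof.
by rewrite !inE -morph_al morph_lower (leqNgt _ (h (al i))) morph_lower -leqNgt.
Qed.

Lemma morph_hang i j : connect (hang al) i j -> connect (hang be) (h i) (h j).
Proof.
case/connectP => p pth ->; elim: p i pth => [|k p IHp] i /=; first by rewrite connect0.
case/andP=> e /IHp; apply: connect_trans; apply: connect1.
case/orP: e => [/eqP->|/andP[/eqP-> s]]; first by rewrite /hang /= morph_sg eqxx.
apply/orP; right; apply/andP; split; first by rewrite morph_al.
by rewrite /same_side -morph_al !morph_lower.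
Qed.

(** [trunk_of] is defined through the numbering but is intrinsic: it is the trunk dart whose reverse
    hangs together with the given dart. *)
Lemma morph_trunk_of i : trunk_of be (h i) = h (trunk_of al i).
Proof.
have [t1 _ _] := trunk_ofP (pre_nc px) i.
have := morph_hang (connect_trunk_of (pre_nc px) i); rewrite morph_al.
move/(trunk_of_hang (pre_nc py)) => ->; apply: (trunk_of_al (pre_nc py)).
by rewrite morph_trunk.
Qed.

Lemma morph_distinguished : trunk_of be (be y.2) = h (trunk_of al (al x.2)).
Proof.
rewrite -morph_trunk_of; case: hi => _ _ _ _ [_ /setP/(_ (h (al x.2)))].
have -> : h (al x.2) \in h @: distinguished (code_map px) by apply/imset_f/porbit_id.
by move/esym/(trunk_of_porbit (pre_nc py)).
Qed.

(** Following the contour from [0] fixes the first face; the root edge then gives a fixed dart in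
    the second face. *)
Lemma morph_id : h ord0 = ord0 -> h =1 id.
Proof.
move=> h0; have hm : h ord_max = ord_max.
  by rewrite -(nc0 (pre_nc px)) morph_al h0 (nc0 (pre_nc py)) (nc0 (pre_nc px)).
have H i j : h i = i -> (i < a) = (j < a) -> h j = j.
  move=> e s; have : connect [rel i j | face_rot i == j] i j.
    by apply: connect_rot => // z; apply: connect1; rewrite /= eqxx.
  case/connectP=> p pth -> {s}; elim: p i pth e => //= z p IHp i /andP[/eqP <- pth] e.
  by apply: IHp pth _; rewrite morph_face_rot e.
move=> j; have [ja|ja] := boolP (j < a); first by apply: (H ord0) => //; rewrite ja.
by apply: (H ord_max) => //=; rewrite (negPf ja); apply/negP; lia.
Qed.

End Morphism.

(* The last condition makes the dart [0] the canonical root. *)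
Definition code_ok k L x :=
  [&& precode x, tight_code x, #|x.1.2| == k.+1, L <= #|trunk x.1.1|
    & trunk_of x.1.1 (x.1.1 x.2) == ord0].

Lemma code_ok_iso k L x y (px : precode x) (py : precode y) :
  code_ok k L x -> code_ok k L y -> isomorphic (code_map px) (code_map py) -> x = y.
Proof.
move=> /and5P[_ _ _ _ /eqP vx] /and5P[_ _ _ _ /eqP vy] [h hi].
have h0 : h ord0 = ord0 by rewrite -{1}vx -(morph_distinguished hi).
have hid := morph_id hi h0.
have eal : x.1.1 = y.1.1.
  by apply/permP=> i; have := morph_al hi i; rewrite !hid.
have iid (v : {set 'I_N}) : h @: v = v by rewrite (eq_imset _ hid) imset_id.
case: (hi) => _ _ _ _ [em ed].
have {}ed : vertex_of x.1.1 x.2 = vertex_of y.1.1 y.2.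
  by rewrite -[RHS]/(distinguished (code_map py)) -ed [RHS]iid.
have {}em : [set vertex_of x.1.1 i | i in x.1.2] = [set vertex_of y.1.1 i | i in y.1.2].
  by rewrite -[RHS]/(marked (code_map py)) -em (eq_imset _ iid) imset_id.
have inj := vertex_of_inj (pre_nc px); rewrite -eal in ed em.
have ux := pre_up px; have uy := pre_up py; rewrite -eal in uy.
have S (A B : {set 'I_N}) : {in A, forall i, up x.1.1 i} -> {in B, forall i, up x.1.1 i} ->
    vertex_of x.1.1 @: A = vertex_of x.1.1 @: B -> A \subset B.
  move=> uA uB e; apply/subsetP=> i iA.
  have : vertex_of x.1.1 i \in vertex_of x.1.1 @: B by rewrite -e imset_f.
  case/imsetP=> j jB /inj -> //; rewrite inE; [exact: uA | exact: uB].
have e2 : x.1.2 = y.1.2 by apply/eqP; rewrite eqEsubset !S.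
have e3 : x.2 = y.2 by apply: inj ed; rewrite inE; [apply: ux (pre_mem px) | apply: uy (pre_mem py)].
by rewrite (surjective_pairing x) (surjective_pairing y) e3 [x.1]surjective_pairing [y.1]surjective_pairing eal e2.
Qed.
End Codes.

(** * Every map with two faces comes from a code *)

Section Labelling.
Variables a' b' : nat.
Local Notation a := a'.+1.
Local Notation N := (a' + b').+2.
Local Notation face_rot := (@face_rot a' b').
Implicit Types (i j d : 'I_N).
Variable M : marked_map.
Hypotheses (c1 : #|face1 M| = a) (c2 : #|face2 M| = b'.+1).
Local Notation ph := (alpha M * sigma M)%g.

Lemma face_porbit r (F : {set dart M}) : F \in faces M -> r \in F -> porbit ph r = F.
Proof. by case/imsetP=> z _ -> ; rewrite -eq_porbit_mem => /eqP. Qed.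

Lemma face1_face : face1 M \in faces M. Proof. by rewrite facesE !inE eqxx. Qed.
Lemma face2_face : face2 M \in faces M. Proof. by rewrite facesE !inE eqxx orbT. Qed.

Lemma faces_disjoint r : r \in face1 M -> r \notin face2 M.
Proof.
move=> h1; apply/negP=> h2; move: (face1_neq_face2 M).
by rewrite -(face_porbit face1_face h1) (face_porbit face2_face h2) eqxx.
Qed.

Lemma face2E r : (r \in face2 M) = (r \notin face1 M).
Proof.
apply/idP/idP; first by apply: contraL; apply: faces_disjoint.
have : porbit ph r \in faces M by apply: imset_f.
by rewrite facesE !inE => /orP[]/eqP <-; rewrite porbit_id.
Qed.

Lemma card_dart : #|dart M| = N.
Proof.
have e : face2 M = ~: face1 M by apply/setP=> r; rewrite inE face2E.
by have := cardsC (face1 M); rewrite -e c1 c2 => <-; lia.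
Qed.

Lemma face_rot_step s (F : {set dart M}) : F \in faces M -> s \in F -> ph s \in F.
Proof. by move=> hF sF; rewrite -(face_porbit hF sF) mem_porbit1. Qed.

(** Otherwise the first face would be stable under [alpha] and [sigma], against connectedness. *)
Lemma root_exists : exists2 r, r \in face1 M & alpha M r \in face2 M.
Proof.
have [s1 h1] : exists s, s \in face1 M by apply/card_gt0P; rewrite c1.
have [s2 h2] : exists s, s \in face2 M by apply/card_gt0P; rewrite c2.
have [/existsP[r /andP[r1 r2]]|/existsPn no] :=
  boolP [exists r, (r \in face1 M) && (alpha M r \in face2 M)]; first by exists r.
have ha x : x \in face1 M -> alpha M x \in face1 M.
  by move=> xF; have := no x; rewrite xF face2E negbK.
have hs x : x \in face1 M -> sigma M x \in face1 M.
  move=> xF; have -> : sigma M x = ph (alpha M x) by rewrite permM alpha_invol.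
  exact: face_rot_step face1_face (ha _ xF).
have /connectP[p pth e] := map_connected s1 s2.
have : s2 \in face1 M.
  rewrite e; elim: p s1 h1 pth {e} => //= z p IHp s1 h1 /andP[/orP[]/eqP-> pth]; apply: IHp pth => //.
    exact: ha.
  exact: hs.
by move/faces_disjoint; rewrite h2.
Qed.

Section Root.
Variable r : dart M.
Hypotheses (r1 : r \in face1 M) (r2 : alpha M r \in face2 M).

(** The second contour starts just after [alpha M r], so that this dart receives the last number and
    the root edge becomes [{0, N - 1}]. *)
Definition dart_of (i : 'I_N) : dart M :=
  if i < a then iter i ph r else iter (i - a) ph (ph (alpha M r)).

Lemma iter_face s (F : {set dart M}) n : F \in faces M -> s \in F -> iter n ph s \in F.
Proof. by move=> hF sF; elim: n => //= n; apply: face_rot_step. Qed.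

Lemma dart_of_face1 i : (dart_of i \in face1 M) = (i < a).
Proof.
rewrite /dart_of; case: ifP => h; first exact: iter_face face1_face _.
apply: negbTE; rewrite -face2E; apply: iter_face face2_face _.
exact: face_rot_step face2_face _.
Qed.

Lemma iter_inj s (F : {set dart M}) n m : F \in faces M -> s \in F ->
  n < #|F| -> m < #|F| -> iter n ph s = iter m ph s -> n = m.
Proof.
move=> hF sF nF mF e; have := uniq_traject_porbit ph s; rewrite (face_porbit hF sF).
move/uniqP => /(_ s n m); rewrite !inE !size_traject !nth_traject //; exact.
Qed.

Lemma dart_of_inj : injective dart_of.
Proof.
move=> i j e; have := dart_of_face1 i; rewrite e dart_of_face1.
move: e; rewrite /dart_of; have := ltn_ord i; have := ltn_ord j.
case: ifP => hi; case: ifP => hj // jN iN e _; apply: val_inj => /=.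
  by apply: iter_inj face1_face r1 _ _ e; rewrite c1.
have q : ph (alpha M r) \in face2 M by apply: face_rot_step face2_face _.
have : i - a = j - a by apply: iter_inj face2_face q _ _ e; rewrite c2; lia.
lia.
Qed.

Lemma dart_of_bij : bijective dart_of.
Proof. by apply: inj_card_bij dart_of_inj _; rewrite card_dart card_ord. Qed.

Lemma dart_of0 : dart_of ord0 = r. Proof. by []. Qed.

Lemma iter_face_card s (F : {set dart M}) : F \in faces M -> s \in F ->
  iter #|F| ph s = s.
Proof. by move=> hF sF; rewrite -(face_porbit hF sF) iter_porbit. Qed.

Lemma dart_of_max : dart_of ord_max = alpha M r.
Proof.
rewrite /dart_of /=; case: ifP => h; first by lia.
rewrite -iterSr -[RHS](iter_face_card face2_face r2) c2.
by have -> : ((a' + b').+1 - a).+1 = b'.+1 by lia.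
Qed.

Lemma dart_of_face_rot i : dart_of (face_rot i) = ph (dart_of i).
Proof.
have [->|/eqP nm] := eqVneq i ord_max.
  by rewrite dart_of_max /dart_of face_rot_max ltnn subnn.
have [e|/eqP ne] := eqVneq (i : nat) a'.
  by rewrite face_rot0 // dart_of0 /dart_of e ltnSn -iterS -c1 iter_face_card // face1_face.
rewrite /dart_of face_rotS //; case: (ltnP i a) => h.
  by rewrite ltnS ifT ?iterS //; lia.
rewrite ifF; last by lia.
by rewrite -iterS; have -> : i.+1 - a = (i - a).+1 by lia.
Qed.

Lemma labelling : exists (x : code a' b') (px : precode x) (g : 'I_N -> dart M),
  @isomorphism (code_map px) M g /\ g ord0 = r.
Proof.
have [g' gK g'K] := dart_of_bij.
have aKf : involutive (fun i => g' (alpha M (dart_of i))).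
  by move=> i; rewrite g'K alpha_invol gK.
pose al := perm (inv_inj aKf).
have galE i : dart_of (al i) = alpha M (dart_of i) by rewrite permE g'K.
have gsgE i : dart_of ((al * face_rot)%g i) = sigma M (dart_of i).
  by rewrite permM dart_of_face_rot galE permM alpha_invol.
have alK : involutive al by move=> i; rewrite !permE.
have alx i : al i != i.
  by apply/eqP => e; have := galE i; rewrite e => h; have := alpha_nofix (dart_of i); rewrite -h eqxx.
have al0 : al ord0 = ord_max by apply: dart_of_inj; rewrite galE dart_of0 dart_of_max.
have nc : noncrossing al.
  apply: euler_noncrossing => //.
  rewrite (card_porbits_morph dart_of_bij gsgE) -card_dart.
  rewrite -(card_porbits_involution (@alpha_invol M) (@alpha_nofix M)).
  (* With two faces the Euler relation says that there are as many vertices as edges. *)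
  have := map_euler M; rewrite -[porbits (_ * _)%g]/(faces M) facesE cards2 face1_neq_face2.
  by move/addIn => ->.
pose S := [set i | up al i && (dart_of @: vertex_of al i \in marked M)].
have V v : v \in vertices M -> exists2 i, up al i & dart_of @: vertex_of al i = v.
  case/imsetP=> z _ ->; exists (parent al (g' z)); first exact: parent_up.
  by rewrite vertex_of_parent // (porbit_morph gsgE) g'K.
have [v uv ev] := V _ (subsetP (marked_vertices M) _ (distinguished_marked M)).
have px : @precode a' b' (al, S, v).
  apply/and3P; split=> //=; first by apply/subsetP=> i; rewrite !inE => /andP[].
  by rewrite inE uv ev distinguished_marked.
exists (al, S, v), px, dart_of; split=> //; split=> //.
- exact: dart_of_bij.
- have E : dart_of @: lower a' b' = face1 M.
    apply/setP=> z; rewrite -(g'K z) (mem_imset _ _ dart_of_inj) inE.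
    by rewrite dart_of_face1.
  split=> //; apply/setP=> z; rewrite -(g'K z) (mem_imset _ _ dart_of_inj) !inE.
  by rewrite face2E dart_of_face1.
split=> //; apply/setP=> w; apply/imsetP/idP => [[w' mw' ->]|wM].
  have /imsetP[i] : w' \in [set vertex_of al i | i in S] by [].
  by rewrite inE => /andP[_ h] ->.
have [i ui ei] := V w (subsetP (marked_vertices M) _ wM).
exists (vertex_of al i) => //.
by apply: (imset_f (vertex_of al)); rewrite inE ui ei.
Qed.

End Root.

(** An arbitrary root on the cycle gives a first code. The trunk dart it assigns to the
    distinguished vertex is taken as the root of a second code, where by invariance that dart
    becomes [ord0]. *)
Lemma canonical_labelling : exists (x : code a' b') (px : precode x),
  isomorphic M (code_map px) /\ trunk_of x.1.1 (x.1.1 x.2) = ord0.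
Proof.
have [r r1 r2] := root_exists.
have [x [px [g [gi _]]]] := labelling r1 r2.
pose d := trunk_of x.1.1 (x.1.1 x.2).
have [dT _ _] := trunk_ofP (pre_nc px) (x.1.1 x.2); rewrite -/d in dT.
have [gb ga _ [g1 g2] _] := gi.
have q1 : g d \in face1 M.
  by rewrite -g1 (mem_imset _ _ (bij_inj gb)) inE; move: dT; rewrite inE => /andP[].
have q2 : alpha M (g d) \in face2 M.
  rewrite -ga -g2 (mem_imset _ _ (bij_inj gb)) !inE -leqNgt.
  by move: dT; rewrite inE => /andP[].
have [y [py [f [fi f0]]]] := labelling q1 q2.
exists y, py; split; first by apply: isomorphic_sym; exists f.
have [[f' fK f'K] _ _ _ _] := fi.
have hi := isomorphism_comp gi (isomorphism_inv fK f'K fi).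
by rewrite (morph_distinguished hi) /= -/d -f0 fK.
Qed.
End Labelling.

Lemma count_codes k c m1 m2 a' b' : a'.+1 = 2 * m1 -> b'.+1 = 2 * m2 ->
  count_up_to_iso (counted_map c k m1 m2) #|[set x : code a' b' | code_ok k (2 * c.+1) x]|.
Proof.
move=> ea eb; set X := [set x | _].
have pX x : x \in X -> precode x by rewrite inE => /and5P[].
exists (fun i => code_map (pX _ (enum_valP i))); split.
- move=> i; have := enum_valP i; rewrite {1}inE => /and5P[_ t /eqP m l _].
  by apply/counted_codeP.
- move=> i j /(code_ok_iso (k := k) (L := 2 * c.+1)) H; apply: enum_val_inj; apply: H.
    by have := enum_valP i; rewrite inE.
  by have := enum_valP j; rewrite inE.
move=> M cM; have [_ c1 c2 _ _] := cM.
have [x [px [xi x0]]] := canonical_labelling (etrans c1 (esym ea)) (etrans c2 (esym eb)).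
have [t m l] := (counted_codeP px c k ea eb).1 (counted_map_iso xi cM).
have xX : x \in X by rewrite inE /code_ok px t m l x0 !eqxx.
exists (enum_rank_in xX x).
(* [code_map] takes a proof as argument: the equation is used for an arbitrary membership proof,
   then two proofs of a boolean are identified. *)
suff : forall y (yX : y \in X), y = x -> isomorphic M (code_map (pX y yX)).
  by apply; apply: enum_rankK_in.
by move=> y yX e; subst y; rewrite (bool_irrelevance (pX x yX) px).
Qed.

(** * Matchings and height functions *)

Section Heights.
Variables a' b' : nat.
Local Notation a := a'.+1.
Local Notation N := (a' + b').+2.
Local Notation face_rot := (@face_rot a' b').
Implicit Types (i j d x y : 'I_N) (al be : {perm 'I_N}).

Lemma ord_eq_nat i j : i = j :> nat -> i = j. Proof. exact: val_inj. Qed.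

Section FromHeights.
Variables (U : pred 'I_N) (h : nat -> nat).
Hypotheses (h0 : h 0 = 0) (hN : h N = 0) (hpos : forall x : nat, 0 < x < N -> 0 < h x).
Hypothesis hstep : forall i, if U i then h i.+1 = (h i).+1 else h i = (h i.+1).+1.

Definition arc i j :=
  [/\ i < j, U i, ~~ U j, h j.+1 = h i & forall k : nat, i < k <= j -> h i < h k].

Lemma arc_injr i j j' : arc i j -> arc i j' -> j = j'.
Proof.
move=> [h1 _ _ h2 h3] [h4 _ _ h5 h6]; apply: ord_eq_nat.
by have := h3 j'.+1; have := h6 j.+1; lia.
Qed.

Lemma arc_injl i i' j : arc i j -> arc i' j -> i = i'.
Proof.
move=> [h1 _ _ h2 h3] [h4 _ _ h5 h6]; apply: ord_eq_nat.
by have := h3 i'; have := h6 i; lia.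
Qed.

(** A step up is matched with the first return to its starting height, a step down with the last
    departure from its final height. The defaults [ord_max] and [ord0] qualify because [h] vanishes
    at both ends. *)
Definition mate i : 'I_N :=
  if U i then [arg min_(j < ord_max | (i <= j) && (h j.+1 <= h i)) (j : nat)]
  else [arg max_(j > ord0 | (j <= i) && (h j <= h i.+1)) (j : nat)].

Lemma mate_up i : U i -> arc i (mate i).
Proof.
move=> ui; rewrite /mate ui; case: arg_minnP => [|j /andP[ij hj] mn].
  by rewrite /= hN -ltnS ltn_ord.
have hi := hstep i; rewrite ui in hi.
have hk (k : nat) : i < k <= j -> h i < h k.
  move=> /andP[ik kj]; rewrite ltnNge; apply/negP => hki.
  have kN : k.-1 < N by have := ltn_ord j; lia.
  have := mn (Ordinal kN); rewrite /= (ltn_predK ik) hki; lia.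
have lt : i < j.
  by rewrite ltn_neqAle ij andbT; apply/eqP => e; move: hj; rewrite -e hi; lia.
have hij := hk j; have := hstep j; case: ifP => uj; first by lia.
by split=> //; rewrite ?uj //; lia.
Qed.

Lemma mate_down i : ~~ U i -> arc (mate i) i.
Proof.
move=> ui; rewrite /mate (negPf ui); case: arg_maxnP => [|j /andP[ij hj] mx].
  by rewrite /= h0.
have hi := hstep i; rewrite (negPf ui) in hi.
have lt : j < i.
  by rewrite ltn_neqAle ij andbT; apply/eqP => e; move: hj; rewrite e hi; lia.
have hk (k : nat) : j < k <= i -> h i.+1 < h k.
  move=> /andP[ik kj]; rewrite ltnNge; apply/negP => hki.
  have kN : k < N by have := ltn_ord i; lia.
  have := mx (Ordinal kN); rewrite /= kj hki; lia.
have hij := hk j.+1; have := hstep j; case: ifP => uj e; last by lia.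
have e' : h j = h i.+1 by lia.
by split=> //; rewrite e'.
Qed.

Lemma mateK : involutive mate.
Proof.
move=> i; have [ui|ui] := boolP (U i).
  have A := mate_up ui; have [_ _ um _ _] := A.
  exact: arc_injl (mate_down um) A.
have A := mate_down ui; have [_ um _ _ _] := A.
exact: arc_injr (mate_up um) A.
Qed.

Lemma mate_gt i : (i < mate i) = U i.
Proof.
have [ui|ui] := boolP (U i); first by have [] := mate_up ui.
by have [h1 _ _ _ _] := mate_down ui; apply/negbTE; rewrite -leqNgt ltnW.
Qed.

Lemma matching_of_heights :
  exists2 al, noncrossing al & forall i, up al i = U i.
Proof.
pose al := perm (inv_inj mateK); have E i : al i = mate i by rewrite permE.
exists al => [|i]; last by rewrite /up E mate_gt.
apply/and4P; split.
- have u0 : U ord0 by have := hstep ord0; case: ifP => // _; rewrite /= h0.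
  (* The step matched with [0] ends at height 0, and [h] is positive before [N]. *)
  have [h1 _ _ h2 _] := mate_up u0; rewrite E; apply/eqP/ord_eq_nat => /=.
  have := @hpos (mate ord0).+1; have := ltn_ord (mate ord0); move: h2; rewrite /= h0; lia.
- by apply/forallP => i; rewrite !E mateK.
- apply/forallP => i; rewrite E; apply/eqP => e.
  by have [/mate_up|/mate_down] := boolP (U i); rewrite e => -[]; rewrite ltnn.
apply/forallP=> i; apply/forallP=> j; apply/implyP; rewrite !E => /andP[ij jm].
have ui : U i by rewrite -mate_gt (ltn_trans ij).
have A := mate_up ui; have [_ _ _ hm hk] := A.
have [uj|uj] := boolP (U j); last by have [h1 _ _ _ _] := mate_down uj; apply: ltn_trans jm.
have A' := mate_up uj; have [_ _ _ hm' hk'] := A'.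
rewrite ltn_neqAle; apply/andP; split.
  apply/eqP => /ord_eq_nat e; rewrite e in A'.
  by move: ij; rewrite (arc_injl A A') ltnn.
rewrite leqNgt; apply/negP => lt.
by have := hk' (mate i).+1; have := hk j; lia.
Qed.

End FromHeights.

Definition height al (x : nat) := #|[set d : 'I_N | covers al d x]|.

Section Noncrossing.
Variable al : {perm 'I_N}.
Hypothesis nc : noncrossing al.

Lemma height0 : height al 0 = 0.
Proof. by apply: eq_card0 => d; rewrite inE. Qed.

Lemma heightN : height al N = 0.
Proof.
apply: eq_card0 => d; rewrite inE; apply/negbTE.
by rewrite negb_and -(ltnNge (al d)) (ltn_ord (al d)) orbT.
Qed.

Lemma height_trunk : height al a = #|trunk al|.
Proof. by apply: eq_card => d; rewrite !inE. Qed.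

Lemma height_gt0 (x : nat) : 0 < x < N -> 0 < height al x.
Proof.
move=> hx; apply/card_gt0P; exists ord0; rewrite inE /covers (nc0 nc) /=; lia.
Qed.

Lemma height_up i : up al i -> height al i.+1 = (height al i).+1.
Proof.
rewrite /up => ui; have -> : (height al i).+1 = #|i |: [set d | covers al d i]|.
  by rewrite cardsU1 inE /covers ltnn.
apply: eq_card => d; rewrite !inE /covers; have [->|ne] := eqVneq d i; first by lia.
have n1 : d <> i :> nat by move/ord_eq_nat => e; rewrite e eqxx in ne.
suff : al d <> i :> nat \/ i < d by lia.
have [e|/eqP] := eqVneq (al d : nat) i; [right|by left].
by move: ui; rewrite -(ord_eq_nat e) ncK.
Qed.

Lemma height_down i : ~~ up al i -> height al i = (height al i.+1).+1.
Proof.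
rewrite /up -leqNgt => di; have lt : al i < i by have := @nc_neq _ _ _ nc i; lia.
have -> : (height al i.+1).+1 = #|al i |: [set d | covers al d i.+1]|.
  by rewrite cardsU1 inE /covers ncK // ltnn andbF.
apply: eq_card => d; rewrite !inE /covers; have [->|ne] := eqVneq d (al i).
  by rewrite ncK //; lia.
have n1 : al d <> i :> nat by move/ord_eq_nat => e; rewrite -e ncK // eqxx in ne.
have [->|ne'] := eqVneq d i; first by lia.
have n2 : d <> i :> nat by move/ord_eq_nat => e; rewrite e eqxx in ne'.
by rewrite /=; lia.
Qed.

Lemma covers_al d i : up al i -> covers al d (al i).+1 = covers al d i.
Proof.
rewrite /up /covers => ui; have [->|ne] := eqVneq d i; first by lia.
have [->|ne2] := eqVneq d (al i); first by rewrite ncK //; lia.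
have n1 : al d <> i :> nat by move/ord_eq_nat => e; rewrite -e ncK // eqxx in ne2.
have n2 : al d <> al i :> nat by move/nc_inj => e; rewrite e eqxx in ne.
have n3 : d <> i :> nat by move/ord_eq_nat => e; rewrite e eqxx in ne.
have n4 : d <> al i :> nat by move/ord_eq_nat => e; rewrite e eqxx in ne2.
have := @nc_lt _ _ _ nc i d; have := @nc_gt _ _ _ nc i d.
have := @nc_lt _ _ _ nc d i; have := @nc_gt _ _ _ nc d i; lia.
Qed.

Lemma height_al i : up al i -> height al (al i).+1 = height al i.
Proof. by move=> ui; apply: eq_card => d; rewrite !inE covers_al. Qed.

Lemma height_gt i k : i < k <= al i -> height al i < height al k.
Proof.
move=> ik; apply: proper_card; apply/properP; split.
  apply/subsetP=> d; rewrite !inE /covers => /andP[di ia].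
  have [e|ne] := eqVneq (al d : nat) i; first by move: di ik; rewrite -(ord_eq_nat e) ncK //; lia.
  by have := @nc_lt _ _ _ nc d i di; lia.
by exists i; rewrite inE /covers ?ltnn.
Qed.

End Noncrossing.

Lemma height_eq al (U : pred 'I_N) (h : nat -> nat) : noncrossing al ->
  (forall i, up al i = U i) -> h 0 = 0 ->
  (forall i, if U i then h i.+1 = (h i).+1 else h i = (h i.+1).+1) ->
  forall x : nat, x <= N -> height al x = h x.
Proof.
move=> nc alU h0 hs; elim=> [|x IHx] xN; first by rewrite height0 h0.
have := hs (Ordinal xN); rewrite -alU /= -IHx ?(ltnW xN) //.
case: ifP => [u|/negbT u]; first by rewrite (height_up nc u).
by rewrite (height_down nc u) /= => -[].
Qed.

(** The openings determine the heights, and an opening dart is matched with the first return to its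
    height. *)
Lemma noncrossing_inj al be : noncrossing al -> noncrossing be ->
  (forall i, up al i = up be i) -> al = be.
Proof.
move=> na nb e.
have hE : forall x : nat, x <= N -> height al x = height be x.
  apply: (height_eq na e (height0 be)) => i; case: ifP => u; first exact: height_up.
  by apply: height_down; rewrite ?u.
have H i : up al i -> al i = be i.
  move=> ui; have vi : up be i by rewrite -e.
  apply: ord_eq_nat; have [lt|lt|//] := ltngtP (al i) (be i).
    have := @height_gt _ nb i (al i).+1; rewrite -!hE ?ltn_ord ?(ltnW (ltn_ord _)) //.
    by rewrite height_al // ltnn; move: ui; rewrite /up; lia.
  have := @height_gt _ na i (be i).+1; rewrite !hE ?ltn_ord ?(ltnW (ltn_ord _)) //.
  by rewrite height_al // ltnn; move: vi; rewrite /up; lia.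
apply/permP=> i; have [/H //|di] := boolP (up al i).
have ui : up al (al i).
  by move: di; rewrite /up ncK //; have := @nc_neq _ _ _ na i; lia.
by have := H _ ui; rewrite ncK // => {2}->; rewrite ncK.
Qed.

(* The distinguished vertex hangs from the base of the trunk iff the contour
   comes down to height 1 between it and the junction of the two faces. *)
Lemma trunk_of0E al i : noncrossing al -> up al i ->
  (trunk_of al (al i) = ord0) <->
  (exists2 k : nat, (if i < a then i < k <= a else a <= k <= i) & height al k = 1).
Proof.
move=> nc ui.
have h1P (k : nat) : 0 < k < N -> height al k = 1 -> forall d, covers al d k -> d = ord0.
  move=> kN /eqP/cards1P[e eE] d dk; have c0 : covers al ord0 k by rewrite /covers (nc0 nc) /=; lia.
  have : d \in [set d | covers al d k] by rewrite inE.
  have : ord0 \in [set d | covers al d k] by rewrite inE.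
  by rewrite eE !inE => /eqP -> /eqP.
have h2P (k : nat) : 0 < k < N -> height al k <> 1 -> exists2 d, d <> ord0 & covers al d k.
  move=> kN k1; have c0 : covers al ord0 k by rewrite /covers (nc0 nc) /=; lia.
  have := cardsD1 ord0 [set d | covers al d k]; rewrite inE c0 -/(height al k) => e.
  have : 0 < #|[set d | covers al d k] :\ ord0| by lia.
  by case/card_gt0P => d; rewrite !inE => /andP[/eqP h1 h2]; exists d.
have ci : corner a' (al i) = al i by rewrite /corner; case: eqP => //; move: ui; rewrite /up; lia.
have [tT tC tM] := trunk_ofP nc (al i); rewrite ci in tC tM.
have iT0 : i \in trunk al -> trunk_of al (al i) = i by apply: trunk_of_al.
split=> [t0|[k hk k1]]; last first.
  have kN : 0 < k < N by case: ifP hk; have := ltn_ord i; lia.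
  have [iT|iT] := boolP (i \in trunk al).
    rewrite iT0 //; apply: (h1P k) => //.
    by move: iT hk ui; rewrite /covers inE /up; case: ifP; lia.
  apply: (h1P k) => //; set d := trunk_of al (al i) in tT tC tM *.
  have [e|ne] := eqVneq d i; first by rewrite -e tT in iT.
  have n3 : d <> i :> nat by move/ord_eq_nat => e; rewrite e eqxx in ne.
  move: tT tC iT hk ui; rewrite /covers !inE /up; have := @nc_lt _ _ _ nc i d; case: ifP; lia.
have T0 d : d \in trunk al -> covers al d (al i) -> d = ord0.
  by move=> dT dC; have := tM d dT dC; rewrite t0 /= => h; apply: ord_eq_nat => /=; lia.
pose R (k : nat) := if i < a then i < k <= a else a <= k <= i.
have [/hasP[k _ /andP[h1 /eqP h2]]|/hasPn no'] :=
  boolP (has (fun k => R k && (height al k == 1)) (iota 0 N)); first by exists k.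
have no (k : nat) : R k -> height al k <> 1.
  move=> Rk /eqP h1; have := no' k; rewrite mem_iota Rk h1 /= => /(_ _)/negP; apply=> //.
  by move: Rk; rewrite /R; have := ltn_ord i; case: ifP; lia.
have Tbase : R a -> exists2 d, d <> ord0 & (d \in trunk al) && covers al d a.
  move=> Ra; have [|d d0 dC] := h2P a _ (no _ Ra); first by lia.
  by exists d => //; rewrite dC andbT inE; move: dC; rewrite /covers; lia.
rewrite -/(R _) in no * => {no'}.
have [ia|ia] := boolP (i < a).
  (* Spread from the junction down to [i.+1]: some trunk arc other than [0] covers each corner [k].
     If the arc [d] found at [k.+1] opens exactly at [k], the height at [k] provides another arc
     over [k]; it encloses [d], hence is in the trunk. *)
  have key (n k : nat) : i < k <= a -> a - k = n ->
      exists2 d, d <> ord0 & (d \in trunk al) && covers al d k.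
    elim: n k => [|n IHn] k hk kn.
      have -> : k = a by lia.
      by apply: Tbase; rewrite /R ia; lia.
    have [||d d0 /andP[dT dC]] := IHn k.+1; [lia | lia | ].
    have [lt|ge] := ltnP d k; first by exists d; rewrite // dT; move: dC; rewrite /covers; lia.
    have kd : k = d by move: dC; rewrite /covers; lia.
    have [||e e0 eC] := h2P k; [by have := ltn_ord i; lia | by apply: no; rewrite /R ia | ].
    exists e => //; rewrite eC andbT; move: dT eC; rewrite !inE /covers kd => dT eC.
    have ne : al e <> d :> nat.
      by move/ord_eq_nat => e'; move: dT eC; rewrite -e' ncK //; lia.
    by have := @nc_lt _ _ _ nc e d; lia.
  have [||d d0 /andP[dT dC]] := key (a - i.+1) i.+1; [lia | lia | ].
  case: d0; have [iT|iT] := boolP (i \in trunk al).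
    have i0 : i = ord0 by rewrite -t0 iT0.
    by apply: ord_eq_nat; move: dC; rewrite i0 /covers /=; lia.
  apply: T0 => //; have n3 : d <> i :> nat by move/ord_eq_nat => e; rewrite -e dT in iT.
  by move: dT dC iT; rewrite !inE /covers; move: ui; rewrite /up; lia.
(* Mirror argument from the junction up to [i], at the closing ends of the trunk arcs. *)
have key (n k : nat) : a <= k <= i -> k - a = n ->
    exists2 d, d <> ord0 & (d \in trunk al) && covers al d k.
  elim: n k => [|n IHn] k hk kn.
    have -> : k = a by lia.
    by apply: Tbase; rewrite /R (negPf ia); lia.
  case: k hk kn => [|k] hk kn; first by lia.
  have [||d d0 /andP[dT dC]] := IHn k; [lia | lia | ].
  have [lt|ge] := ltnP k (al d); first by exists d; rewrite // dT; move: dC; rewrite /covers; lia.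
  have kd : al d = k :> nat by move: dC; rewrite /covers; lia.
  have [||e e0 eC] := h2P k.+1; [by have := ltn_ord i; lia | by apply: no; rewrite /R (negPf ia) | ].
  exists e => //; rewrite eC andbT; move: dT eC; rewrite !inE /covers => dT eC.
  have [e'|ne] := eqVneq e d; first by move: eC; rewrite e'; lia.
  have n2 : e <> al d.
    by move=> e'; move: eC; rewrite e' ncK //; lia.
  have n3 : e <> al d :> nat by move/ord_eq_nat.
  have n4 : e <> d :> nat by move/ord_eq_nat => e'; rewrite e' eqxx in ne.
  by have := @nc_lt _ _ _ nc d e; lia.
have [||d d0 /andP[dT dC]] := key (i - a) i; [lia | lia | ].
case: d0; apply: T0 => //; move: dT dC ui; rewrite inE /covers /up => dT dC ui.
have ne : al d <> i :> nat by move/ord_eq_nat => e; move: ui dT dC; rewrite -e ncK //; lia.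
by have := @nc_lt _ _ _ nc d i; lia.
Qed.
End Heights.

(** * Contour words *)

(* [None] closes an arc, [Some None] opens an arc whose vertex is unmarked,
   [Some (Some d)] one whose vertex is marked, and distinguished iff [d]. *)
Definition letter : finType := option (option bool).
Definition Dn : letter := None.
Definition Bu : letter := Some None.
Definition Au : letter := Some (Some false).
Definition Pu : letter := Some (Some true).
Definition is_up (l : letter) := l != Dn.
Definition is_dn (l : letter) := l == Dn.

Section Words.
Variable o : pred letter.
Implicit Types (s : seq letter) (h : nat) (g : nat -> nat).

(** [o] selects the letters that raise the height: the openings in the second face, the closings in
    the first, which is read backwards. The truncation of [h.-1] does no harm in [reaches0], which
    asks for [0 < h] before each step. *)
Definition step h l := if o l then h.+1 else h.-1.

Fixpoint reaches0 h s :=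
  if s is l :: s' then (0 < h) && reaches0 (step h l) s' else h == 0.

(* The distinguished mark may only occur once height [1] has been reached,
   that is, in the tree at the foot of the trunk. *)
Fixpoint zoned h s :=
  if s is l :: s' then (h == 1) || ((l != Pu) && zoned (step h l) s') else true.

Definition level h s j := foldl step h (take j s).

Lemma levelS h s j : j < size s -> level h s j.+1 = step (level h s j) (nth Dn s j).
Proof. by move=> js; rewrite /level (take_nth Dn) // -cats1 foldl_cat. Qed.

Lemma reaches0P h s g : g 0 = h ->
  (forall j, j < size s -> g j.+1 = step (g j) (nth Dn s j)) ->
  reflect ((forall j, j < size s -> 0 < g j) /\ g (size s) = 0) (reaches0 h s).
Proof.
elim: s h g => [|l s IHs] h g g0 gS /=.
  by apply: (iffP eqP) => [e|[_ <-]]; [split; rewrite ?g0 | rewrite g0].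
have g1 : g 1 = step h l by rewrite (gS 0) // g0.
have IH := IHs _ (fun j => g j.+1) g1 (fun j js => gS j.+1 js).
apply: (iffP andP) => [[h0 /IH[gp gN]]|[gp gN]].
  by split=> // -[|j] js; [rewrite g0 | apply: gp].
split; first by rewrite -g0 gp.
by apply/IH; split=> // j js; apply: gp.
Qed.

Lemma zonedP h s g : g 0 = h ->
  (forall j, j < size s -> g j.+1 = step (g j) (nth Dn s j)) ->
  reflect (forall j, j < size s -> nth Dn s j = Pu -> exists2 k, k <= j & g k = 1)
    (zoned h s).
Proof.
elim: s h g => [|l s IHs] h g g0 gS /=; first by apply: ReflectT.
have [h1|h1] /= := eqVneq h 1.
  by apply: ReflectT => j _ _; exists 0; rewrite ?g0.
have g1 : g 1 = step h l by rewrite (gS 0) // g0.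
have IH := IHs _ (fun j => g j.+1) g1 (fun j js => gS j.+1 js).
apply: (iffP andP) => [[lP /IH H] [|j] js jP|H].
- by rewrite (jP : l = Pu) eqxx in lP.
- by have [k kj k1] := H j js jP; exists k.+1.
have G (j : nat) : j < (size s).+1 -> nth Dn (l :: s) j = Pu ->
    exists2 k, k < j & g k.+1 = 1.
  move=> js jP; have [[|k] kj k1] := H j js jP; last by exists k.
  by move: h1; rewrite -g0 k1.
split; first by apply/eqP => lP; have [] := G 0 isT lP.
by apply/IH => j js jP; have [k kj k1] := G j.+1 js jP; exists k.
Qed.

End Words.

(* Tightness: a leaf is an opening dart immediately followed by its mate. *)
Definition no_bare_peak : rel letter := [rel x y | ~~ ((x == Bu) && (y == Dn))].
Definition no_bare_peak_rev : rel letter := [rel x y | ~~ ((x == Dn) && (y == Bu))].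

(** * Codes and pairs of words *)

Section CodeWords.
Variables a' b' : nat.
Local Notation a := a'.+1.
Local Notation b := b'.+1.
Local Notation N := (a' + b').+2.
Local Notation face_rot := (@face_rot a' b').
Implicit Types (i j d : 'I_N) (x : code a' b') (p : a.-tuple letter * b.-tuple letter).

(** Tightness is a condition on each word separately, as no leaf straddles the junction. There are
    [k] letters [Au] for [k + 1] marked vertices, the remaining one being [Pu]. *)
Definition valid_words L k p :=
  [&& [&& reaches0 is_dn L p.1, sorted no_bare_peak_rev p.1 & zoned is_dn L p.1],
      [&& reaches0 is_up L p.2, sorted no_bare_peak p.2 & zoned is_up L p.2],
      count_mem Pu p.1 + count_mem Pu p.2 == 1
    & count_mem Au p.1 + count_mem Au p.2 == k].

(* The first face is read backwards, so that both paths start at the junction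
   of the two faces and descend to [0]. *)
Definition words_of (f : 'I_N -> letter) : a.-tuple letter * b.-tuple letter :=
  ([tuple f (inord (a' - j)) | j < a], [tuple f (inord (a + j)) | j < b]).

Definition letters_of p (i : 'I_N) : letter :=
  if i < a then nth Dn p.1 (a' - i) else nth Dn p.2 (i - a).

Lemma words_ofK p : words_of (letters_of p) = p.
Proof.
case: p => u w; congr pair; apply: eq_from_tnth => j; rewrite tnth_mktuple /letters_of.
  rewrite inordK; last by lia.
  rewrite ifT; last by lia.
  by rewrite (tnth_nth Dn) /=; congr nth; have := ltn_ord j; lia.
rewrite inordK; last by have := ltn_ord j; lia.
rewrite ifF; last by lia.
by rewrite (tnth_nth Dn) /=; congr nth; lia.
Qed.

Lemma nth_words1 f (j : nat) : j < a -> nth Dn (words_of f).1 j = f (inord (a' - j)).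
Proof. by move=> ja; rewrite -(tnth_nth Dn (words_of f).1 (Ordinal ja)) tnth_mktuple. Qed.

Lemma nth_words2 f (j : nat) : j < b -> nth Dn (words_of f).2 j = f (inord (a + j)).
Proof. by move=> ja; rewrite -(tnth_nth Dn (words_of f).2 (Ordinal ja)) tnth_mktuple. Qed.

Lemma letters_ofK f : letters_of (words_of f) =1 f.
Proof.
move=> i; rewrite /letters_of; case: ifP => ia.
  by rewrite nth_words1; [congr f; apply: ord_eq_nat; rewrite inordK; lia | lia].
have := ltn_ord i => iN.
by rewrite nth_words2; [congr f; apply: ord_eq_nat; rewrite inordK; lia | lia].
Qed.

Lemma count_words (q : pred letter) f :
  count q (words_of f).1 + count q (words_of f).2 = #|[set i | q (f i)]|.
Proof.
have C n (t : n.-tuple letter) : count q t = \sum_(0 <= j < n) q (nth Dn t j).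
  by rewrite -sumn_count sumnE big_map (big_nth Dn) size_tuple.
pose F (j : nat) : nat := q (f (inord j)).
have -> : #|[set i | q (f i)]| = \sum_(0 <= j < N) F j.
  rewrite -sum1dep_card big_mkcond big_mkord; apply: eq_bigr => i _.
  by rewrite /F inord_val; case: (q _).
rewrite (big_cat_nat (n := a)) //; last by lia.
rewrite (C a) (C b); congr (_ + _).
  rewrite [RHS]big_nat_rev; apply: eq_big_nat => j /andP[_ ja].
  by rewrite nth_words1 // /F; congr (nat_of_bool (q (f (inord _)))); lia.
have e : N = b + a by lia.
rewrite e -{2}[a]add0n big_addn addnK; apply: eq_big_nat => j /andP[_ ja].
by rewrite nth_words2 // /F (addnC a).
Qed.

Section Encode.
Variables (x : code a' b') (px : precode x).
Local Notation al := x.1.1.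
Let nc : noncrossing al := pre_nc px.

Definition letter_of i : letter :=
  if ~~ up al i then Dn else if i == x.2 then Pu else if i \in x.1.2 then Au else Bu.

Lemma letter_of_up i : is_up (letter_of i) = up al i.
Proof. by rewrite /letter_of; case: (up al i) => //=; case: ifP => //; case: ifP. Qed.

Lemma letter_of_dn i : (letter_of i == Dn) = ~~ up al i.
Proof. by rewrite -letter_of_up negbK. Qed.

Lemma letter_ofP i : (letter_of i == Pu) = (i == x.2).
Proof.
rewrite /letter_of; case: (boolP (up al i)) => [_|ui] /=.
  by case: ifP => //; case: ifP.
by apply/esym/negbTE; apply: contraNneq ui => ->; apply: (pre_up px (pre_mem px)).
Qed.

Lemma letter_ofA i : (letter_of i == Au) = (i \in x.1.2) && (i != x.2).
Proof.
rewrite /letter_of; case: (boolP (up al i)) => [_|ui] /=.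
  by case: (i == x.2); case: (i \in x.1.2).
apply/esym/negbTE; apply: contra ui => /andP[iS _]; exact: (pre_up px iS).
Qed.

Lemma letter_ofB i : (letter_of i == Bu) = up al i && (i \notin x.1.2).
Proof.
rewrite /letter_of; case: (boolP (up al i)) => [_|ui] //=.
case: (eqVneq i x.2) => [->|_]; first by rewrite (pre_mem px).
by case: (i \in x.1.2).
Qed.

Let w := words_of letter_of.

Lemma level1 (j : nat) : j < size w.1 ->
  height al (a - j.+1) = step is_dn (height al (a - j)) (nth Dn w.1 j).
Proof.
rewrite size_tuple => ja; rewrite nth_words1 // /step /is_dn letter_of_dn.
have e : (inord (a' - j) : 'I_N) = a - j.+1 :> nat by rewrite inordK; lia.
set i : 'I_N := inord (a' - j) in e *; have -> : a - j = i.+1 by rewrite e; lia.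
by rewrite -e; case: (boolP (up al i)) => [/height_up->|/(height_down nc)->].
Qed.

Lemma level2 (j : nat) : j < size w.2 ->
  height al (a + j.+1) = step is_up (height al (a + j)) (nth Dn w.2 j).
Proof.
rewrite size_tuple => jb; rewrite nth_words2 // /step letter_of_up.
have e : (inord (a + j) : 'I_N) = a + j :> nat by rewrite inordK; lia.
set i : 'I_N := inord (a + j) in e *; rewrite addnS -e.
by case: (boolP (up al i)) => [/height_up->|/(height_down nc)->].
Qed.

(** At [i = a'] the contour turns back to [0]: the vertex under an arc from [a'] to [a] is that of
    the darts [0] and [a], not a leaf. *)
Lemma peakE i i' : i' = i.+1 :> nat -> i <> a' :> nat -> up al i ->
  (face_rot i == al i) = ~~ up al i'.
Proof.
move=> ei ia ui; have fi : face_rot i = i'.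
  by apply: ord_eq_nat; rewrite face_rotS // => e; have := ltn_ord i'; rewrite ei e /=; lia.
rewrite fi; apply/eqP/idP => [e|di].
  by rewrite e /up (ncK nc) -e ei; lia.
apply: ord_eq_nat; move: ui di; rewrite /up -leqNgt => ui di.
by have := @nc_gt _ _ _ nc i i'; have := @nc_neq _ _ _ nc i'; lia.
Qed.

Lemma tight_words : tight_code x = sorted no_bare_peak_rev w.1 && sorted no_bare_peak w.2.
Proof.
apply/forallP/andP => [t|[/(sortedP Dn) s1 /(sortedP Dn) s2] i].
  have T i i' : i' = i.+1 :> nat -> i <> a' :> nat ->
      ~~ ((letter_of i == Bu) && (letter_of i' == Dn)).
    move=> ei ia; rewrite letter_ofB letter_of_dn; apply/negP => /andP[/andP[ui iS] di].
    by have := implyP (t i); rewrite ui (peakE ei ia ui) di (negPf iS) => /(_ isT).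
  split; apply/(sortedP Dn) => j; rewrite size_tuple => js.
    rewrite !nth_words1 //; last by lia.
    by rewrite /no_bare_peak_rev /= andbC; apply: T; rewrite !inordK; lia.
  rewrite !nth_words2 //; last by lia.
  by rewrite /no_bare_peak /=; apply: T; rewrite !inordK; lia.
apply/implyP=> /andP[ui fi].
have im : i <> ord_max by move=> e; move: ui; rewrite e /up (nc_max nc).
have ia : i <> a' :> nat.
  by move=> e; move: ui fi; rewrite face_rot0 // /up => ui /eqP e'; move: ui; rewrite -e'.
have iN := nc_nmax im; pose i' : 'I_N := Ordinal (iN : i.+1 < N).
have ei : i' = i.+1 :> nat by [].
move: fi; rewrite (peakE ei ia ui) => di; apply: contraLR isT => iS.
have lB : letter_of i == Bu by rewrite letter_ofB ui.
have lD : letter_of i' == Dn by rewrite letter_of_dn.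
have [lt|ge] := ltnP i a'.
  have := s1 (a' - i.+1); rewrite size_tuple !nth_words1; [|lia|lia].
  have -> : inord (a' - (a' - i.+1)) = i' by apply: ord_eq_nat; rewrite inordK; lia.
  have -> : inord (a' - (a' - i.+1).+1) = i by apply: ord_eq_nat; rewrite inordK; lia.
  by rewrite /no_bare_peak_rev /= lB lD; apply; lia.
have := s2 (i - a); rewrite size_tuple !nth_words2; [|lia|lia].
have -> : inord (a + (i - a)) = i by apply: ord_eq_nat; rewrite inordK; lia.
have -> : inord (a + (i - a).+1) = i' by apply: ord_eq_nat; rewrite inordK; lia.
by rewrite /no_bare_peak /= lB lD; apply; lia.
Qed.

(** Reading both words away from the junction turns [trunk_of0E] into one condition for both: height
    1 is reached no later than [Pu]. *)
Lemma zoned_words : (trunk_of al (al x.2) == ord0) =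
  zoned is_dn (height al a) w.1 && zoned is_up (height al a) w.2.
Proof.
have g1 : height al (a - 0) = height al a by rewrite subn0.
have g2 : height al (a + 0) = height al a by rewrite addn0.
have Z1 := zonedP (g := fun j : nat => height al (a - j)) g1 level1.
have Z2 := zonedP (g := fun j : nat => height al (a + j)) g2 level2.
have uv : up al x.2 := pre_up px (pre_mem px).
have vN := ltn_ord x.2.
have [T1 T2] := trunk_of0E nc uv.
apply/eqP/andP => [/T1[k hk k1]|[/Z1 z1 /Z2 z2]].
  split; [apply/Z1 => j | apply/Z2 => j]; rewrite size_tuple => js.
    rewrite nth_words1 // => /eqP; rewrite letter_ofP => /eqP e.
    have {}e : x.2 = a' - j :> nat by rewrite -e inordK; lia.
    exists (a - k); first by move: hk; case: ifP; lia.
    by have -> : a - (a - k) = k by move: hk; case: ifP; lia.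
  rewrite nth_words2 // => /eqP; rewrite letter_ofP => /eqP e.
  have {}e : x.2 = a + j :> nat by rewrite -e inordK; lia.
  exists (k - a); first by move: hk; case: ifP; lia.
  by have -> : a + (k - a) = k by move: hk; case: ifP; lia.
apply: T2; case: (ltnP x.2 a) => va.
  have [||k kj k1] := z1 (a' - x.2); first by rewrite size_tuple; lia.
    apply/eqP; rewrite nth_words1 ?letter_ofP; last by lia.
    by apply/eqP/ord_eq_nat; rewrite inordK; lia.
  by exists (a - k) => //; lia.
have [||k kj k1] := z2 (x.2 - a); first by rewrite size_tuple; lia.
  apply/eqP; rewrite nth_words2 ?letter_ofP; last by lia.
  by apply/eqP/ord_eq_nat; rewrite inordK; lia.
by exists (a + k) => //; lia.
Qed.

Lemma valid_words_of L k : #|trunk al| = L ->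
  valid_words L k w = [&& tight_code x, #|x.1.2| == k.+1 & trunk_of al (al x.2) == ord0].
Proof.
move=> tL; have hL : height al a = L by rewrite height_trunk.
have g1 : height al (a - 0) = L by rewrite subn0.
have g2 : height al (a + 0) = L by rewrite addn0.
rewrite /valid_words !count_words.
have -> : #|[set i | pred1 Pu (letter_of i)]| = 1.
  by rewrite -(cards1 x.2); apply: eq_card => i; rewrite !inE /= letter_ofP.
have -> : #|[set i | pred1 Au (letter_of i)]| = #|x.1.2|.-1.
  rewrite (cardsD1 x.2 x.1.2) (pre_mem px) /=; apply: eq_card => i.
  by rewrite !inE /= letter_ofA andbC.
have S0 : 0 < #|x.1.2| by apply/card_gt0P; exists x.2; apply: pre_mem px.
have -> : reaches0 is_dn L w.1.
  apply/(reaches0P (g := fun j : nat => height al (a - j)) g1 level1); rewrite size_tuple subnn height0; split=> // j ja.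
  by apply: (height_gt0 nc); lia.
have -> : reaches0 is_up L w.2.
  apply/(reaches0P (g := fun j : nat => height al (a + j)) g2 level2); rewrite size_tuple addSn addnS heightN; split=> // j ja.
  by apply: (height_gt0 nc); lia.
have -> : (#|x.1.2|.-1 == k) = (#|x.1.2| == k.+1) by lia.
have -> : tight_code x = sorted no_bare_peak_rev w.1 && sorted no_bare_peak w.2.
  exact: tight_words.
have -> : (trunk_of al (al x.2) == ord0) = zoned is_dn L w.1 && zoned is_up L w.2.
  by rewrite zoned_words hL.
by case: (sorted no_bare_peak_rev _); case: (sorted no_bare_peak _);
  case: (zoned is_dn _ _); case: (zoned is_up _ _); case: (_ == k.+1).
Qed.

End Encode.

Lemma letter_of_marked x (px : precode x) i :
  (i \in x.1.2) = (letter_of x i == Au) || (letter_of x i == Pu).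
Proof.
rewrite (letter_ofA px) (letter_ofP px); case: eqP => [->|_]; first by rewrite (pre_mem px) orbT.
by rewrite andbT orbF.
Qed.

Lemma letter_of_inj x y : precode x -> precode y -> letter_of x =1 letter_of y -> x = y.
Proof.
move=> px py e; have e1 : x.1.1 = y.1.1.
  apply: noncrossing_inj (pre_nc px) (pre_nc py) _ => i.
  by rewrite -!letter_of_up e.
have e2 : x.1.2 = y.1.2 by apply/setP => i; rewrite !letter_of_marked // e.
have e3 : x.2 = y.2 by apply/eqP; rewrite -(letter_ofP py) -e (letter_ofP px).
by case: x y e1 e2 e3 {px py e} => [[? ?] ?] [[? ?] ?] /= -> -> ->.
Qed.

Lemma letters_exist L k p : 0 < L -> valid_words L k p ->
  exists x, [/\ precode x, letter_of x =1 letters_of p & #|trunk x.1.1| = L].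
Proof.
move=> L0 /and4P[/and3P[r1 _ _] /and3P[r2 _ _] cP _].
pose f := letters_of p; pose U i := is_up (f i).
pose g1 := level is_dn L p.1; pose g2 := level is_up L p.2.
have g10 : g1 0 = L by rewrite /g1 /level take0.
have g20 : g2 0 = L by rewrite /g2 /level take0.
have g1S (j : nat) : j < size p.1 -> g1 j.+1 = step is_dn (g1 j) (nth Dn p.1 j) by exact: levelS.
have g2S (j : nat) : j < size p.2 -> g2 j.+1 = step is_up (g2 j) (nth Dn p.2 j) by exact: levelS.
have [p1 e1] := reaches0P g10 g1S r1; have [p2 e2] := reaches0P g20 g2S r2.
rewrite !size_tuple in p1 e1 p2 e2 g1S g2S.
(* The two paths are glued at the junction, where both have height [L], the first one reversed. *)
pose h (t : nat) := if t <= a then g1 (a - t) else g2 (t - a).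
have h0 : h 0 = 0 by rewrite /h subn0.
have ha : h a = L by rewrite /h leqnn subnn.
have hN : h N = 0 by rewrite /h ifF; [have -> : N - a = b by lia | lia].
have hpos (t : nat) : 0 < t < N -> 0 < h t.
  by move=> ht; rewrite /h; case: ifP => ta; [apply: p1 | apply: p2]; lia.
have hge (t : nat) : a <= t -> h t = g2 (t - a).
  rewrite /h; case: ifP => // ta at_; have -> : t = a by lia.
  by rewrite subnn g10 g20.
have hstep i : if U i then h i.+1 = (h i).+1 else h i = (h i.+1).+1.
  have iN := ltn_ord i; have [ia|ia] := ltnP i a.
    have e : U i = ~~ is_dn (nth Dn p.1 (a' - i)) by rewrite /U /f /letters_of ia.
    have js : a' - i < a by lia.
    have := g1S _ js; have q : 0 < g1 (a' - i) by apply: p1.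
    have hi : h i = g1 (a' - i).+1 by rewrite /h ifT; [congr g1; lia | lia].
    have hi1 : h i.+1 = g1 (a' - i) by rewrite /h ifT.
    by rewrite hi hi1 /step e; case: (is_dn _) => /= ->; lia.
  have e : U i = is_up (nth Dn p.2 (i - a)) by rewrite /U /f /letters_of ltnNge ia.
  have js : i - a < b by lia.
  have := g2S _ js; have q : 0 < g2 (i - a) by apply: p2.
  have hi : h i = g2 (i - a) by apply: hge.
  have hi1 : h i.+1 = g2 (i - a).+1 by rewrite hge; [congr g2; lia | lia].
  by rewrite hi hi1 /step e; case: (is_up _) => /= ->; lia.
have [al nc alU] := matching_of_heights h0 hN hpos hstep.
have hE := height_eq nc alU h0 hstep.
have : #|[set i | pred1 Pu (f i)]| == 1.
  by rewrite -count_words words_ofK.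
move/cards1P=> [v vE]; have fv i : (f i == Pu) = (i == v).
  by have /setP/(_ i) := vE; rewrite !inE.
pose S := [set i | (f i == Au) || (f i == Pu)].
have px : precode (al, S, v).
  apply/and3P; split=> //=; last by rewrite inE fv eqxx orbT.
  by apply/subsetP=> i; rewrite !inE alU /U /is_up => /orP[]/eqP->.
exists (al, S, v); split=> // [i|]; last by rewrite -height_trunk hE // ; lia.
rewrite /letter_of /= alU /U -fv inE -/(f i).
by case: (f i) => [[[]|]|].
Qed.

Lemma card_codes L k : 0 < L ->
  #|[set x : code a' b' | code_ok k 0 x && (#|trunk x.1.1| == L)]| =
  #|[set p : a.-tuple letter * b.-tuple letter | valid_words L k p]|.
Proof.
move=> L0; set X := [set x | _]; set Y := [set p | _].
have XE x : x \in X -> [/\ precode x, #|trunk x.1.1| = L & valid_words L k (words_of (letter_of x))].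
  rewrite inE => /andP[/and5P[px t m _ v] /eqP tL]; split=> //.
  by rewrite (valid_words_of px k tL) t m v.
have -> : Y = [set words_of (letter_of x) | x in X].
  apply/setP=> p; apply/idP/imsetP => [pY|[x /XE[_ _ h] ->]]; last by rewrite inE.
  rewrite inE in pY; have [x [px lx tL]] := letters_exist L0 pY.
  have wE : p = words_of (letter_of x).
    rewrite -[LHS]words_ofK; congr pair; apply: eq_from_tnth => j;
    by rewrite !tnth_mktuple lx.
  exists x => //; move: pY; rewrite wE (valid_words_of px k tL) inE /code_ok tL eqxx andbT /=.
  by case/and3P=> -> -> ->; rewrite px.
rewrite card_in_imset // => x y /XE[px _ _] /XE[py _ _] e.
apply: letter_of_inj => // i.
by rewrite -(letters_ofK (letter_of x)) e letters_ofK.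
Qed.

Lemma card_codes_sum k L0 : 0 < L0 ->
  #|[set x : code a' b' | code_ok k L0 x]| =
  \sum_(L0 <= L < a.+1) #|[set p : a.-tuple letter * b.-tuple letter | valid_words L k p]|.
Proof.
move=> L00; rewrite big_nat_cond.
under eq_bigr => L /andP[/andP[h _] _] do rewrite -card_codes ?(leq_trans L00 h) //.
have tb x : #|trunk x.1.1| < a.+1.
  rewrite ltnS -(card_lower a' b'); apply: subset_leq_card.
  by apply/subsetP=> i; rewrite !inE => /andP[].
rewrite -big_nat_cond -sum1dep_card.
under [RHS]eq_bigr => L _ do rewrite -sum1dep_card big_mkcond.
rewrite [RHS]exchange_big big_mkcond; apply: eq_bigr => x _ /=.
have -> : code_ok k L0 x = code_ok k 0 x && (L0 <= #|trunk x.1.1|).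
  rewrite /code_ok /=; case: (precode x); case: (tight_code x); case: (_ == k.+1) => //=.
  by rewrite andbC.
case: (code_ok k 0 x) => /=; last by rewrite big1.
rewrite -big_mkcond sum1_count (eq_count (a2 := pred1 #|trunk x.1.1|)).
  by rewrite count_uniq_mem ?iota_uniq // mem_index_iota tb andbT; case: (_ <= _).
by move=> L /=; rewrite eq_sym.
Qed.

End CodeWords.

(** * Generating functions *)

Section GeneratingFunctions.
Import GRing.Theory Num.Theory.
Local Open Scope ring_scope.

(* [fpoly h n] is [F_h(n)] and [kpoly h n] is [K_h(n)]; their coefficients come
   from Lagrange inversion of [T = z (X + T) / (1 - T)], the series of forests
   of [h] trees being [(1 - T)^(-h)]. *)
Definition kappa (h n j : nat) : rat :=
  (if n is n'.+1 then 'C(n', j) * 'C(h + n + j, j) else 0)%N%:R.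

Definition kpoly (h n : nat) : {poly rat} := \poly_(j < n) kappa h n j.

Definition fpoly (h n : nat) : {poly rat} :=
  \poly_(j < n.+1) (if j is j'.+1 then h%:R * kappa h n j' / j%:R else (n == 0)%:R).

Lemma coef_kpoly h n j : (kpoly h n)`_j = kappa h n j.
Proof.
rewrite coef_poly; case: ltnP => // nj; rewrite /kappa.
by case: n nj => // n nj; rewrite bin_small.
Qed.

Lemma coef_fpoly h n j :
  (fpoly h n)`_j = if j is j'.+1 then h%:R * kappa h n j' / j%:R else (n == 0)%:R.
Proof.
rewrite coef_poly; case: ltnP => //; case: j => // j nj.
by rewrite -coef_kpoly coef_poly ltnNge (nj : n <= j)%N mulr0 mul0r.
Qed.

Lemma deriv_fpoly h n : (fpoly h n)^`() = h%:R *: kpoly h n.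
Proof.
apply/polyP=> j; rewrite coef_deriv coefZ coef_kpoly coef_fpoly.
by rewrite -[LHS]mulr_natr divfK // pnatr_eq0.
Qed.

Lemma coef_mul1X (p : {poly rat}) j :
  ((1 + 'X) * p)`_j = p`_j + (if j is j'.+1 then p`_j' else 0).
Proof. by rewrite mulrDl mul1r coefD coefXM; case: j. Qed.

(** Pascal's rule, used twice. It is the recursion that the first letter imposes on words starting
    at height [h.+1], see [outer_gfS]. *)
Lemma kpolyS h n :
  kpoly h.+1 n.+1 = kpoly h n.+1 + (1 + 'X) * kpoly h.+2 n - kpoly h.+1 n.
Proof.
apply/polyP=> j; rewrite coefB coefD coef_mul1X !coef_kpoly /kappa.
case: n => [|n]; first by case: j => [|j]; rewrite ?coef_kpoly /kappa ?bin0 ?bin0n ?mul0n; ring.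
case: j => [|j]; first by rewrite !bin0; ring.
rewrite !coef_kpoly /kappa.
have -> : (h.+1 + n.+2 + j.+1 = (h + n + j + 3).+1)%N by lia.
have -> : (h + n.+2 + j.+1 = h + n + j + 3)%N by lia.
have -> : (h.+2 + n.+1 + j.+1 = (h + n + j + 3).+1)%N by lia.
have -> : (h.+2 + n.+1 + j = h + n + j + 3)%N by lia.
have -> : (h.+1 + n.+1 + j.+1 = h + n + j + 3)%N by lia.
by rewrite (binS n) (binS (h + n + j + 3)) !natrM !natrD; ring.
Qed.

(** On series in [z], with [T (1 - T) = z (X + T)], [F_h] is [(1 - T)^(-h)] and [K_h] is
    [(1 - T)^(-h-1) T'], the prime being the derivative in [X]. As [z (1 + X) = (1 - T)(T + z)], the
    identity amounts to [T' (1 - 2 T - z) = z], which is the derivative of the equation of [T]. The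
    proof compares coefficients. *)
Lemma fpoly_kpoly h n :
  fpoly h.+2 n + (1 + 'X) * kpoly h.+2 n = kpoly h n.+1.
Proof.
apply/polyP=> j; rewrite coefD coef_mul1X !coef_kpoly coef_fpoly.
case: j => [|j]; rewrite ?coef_kpoly /kappa.
  by case: n => [|n]; rewrite !bin0 ?add0r ?addr0.
case: n => [|n]; first by rewrite bin0n mul0n mulr0 mul0r !addr0.
set B : rat := 'C(h + n + j + 3, j)%:R.
set c : rat := 'C(n, j)%:R; set d : rat := 'C(n, j.+1)%:R.
have j0 : j.+1%:R != 0 :> rat by rewrite pnatr_eq0.
have hd : j.+1%:R * d = (n%:R - j%:R) * c.
  have := mul_bin_left n j; rewrite -/d /c /d => /(congr1 (fun x : nat => x%:R : rat)).
  rewrite !natrM => ->; have [le|lt] := leqP j n; first by rewrite natrB.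
  by rewrite bin_small // !mulr0.
have e1 : ('C(h + n.+2 + j.+1, j.+1))%:R = B * (h + n + 3)%:R / j.+1%:R :> rat.
  apply: (mulIf j0); rewrite divfK //; have := mul_bin_left (h + n + j + 3) j.
  have -> : (h + n + j + 3 - j = h + n + 3)%N by lia.
  have -> : (h + n.+2 + j.+1 = h + n + j + 3)%N by lia.
  by move/(congr1 (fun x : nat => x%:R : rat)); rewrite !natrM => e; rewrite mulrC e mulrC.
have e2 : ('C(h.+2 + n.+1 + j.+1, j.+1))%:R = B * (h + n + j + 4)%:R / j.+1%:R :> rat.
  apply: (mulIf j0); rewrite divfK //; have := mul_bin_diag (h + n + j + 4) j.
  have -> : (h.+2 + n.+1 + j.+1 = h + n + j + 4)%N by lia.
  have -> : ((h + n + j + 4).-1 = h + n + j + 3)%N by lia.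
  by move/(congr1 (fun x : nat => x%:R : rat)); rewrite !natrM => e; rewrite mulrC -e mulrC.
have e3 : (h.+2 + n.+1 + j = h + n + j + 3)%N by lia.
rewrite binS !natrM natrD e1 e2 e3 -/B -/c -/d.
have -> : d = (n%:R - j%:R) * c / j.+1%:R by rewrite -hd mulrC mulKf.
rewrite !natrD -!(addn1 j) -!(addn1 h) !natrD in j0 *.
by field.
Qed.

Lemma polyrat_inj (p q : {poly rat}) : p`_0 = q`_0 -> p^`() = q^`() -> p = q.
Proof.
move=> e0 e; apply/polyP=> -[//|j]; have /polyP/(_ j) := e; rewrite !coef_deriv => /eqP.
by rewrite -subr_eq0 -mulrnBl mulrn_eq0 /= subr_eq0 => /eqP.
Qed.

(** The constant terms agree, and the derivative of the identity is [h.+1] times [kpolyS] plus one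
    instance of [fpoly_kpoly]. *)
Lemma fpolyS h n :
  fpoly h.+1 n.+1 = fpoly h n.+1 + (1 + 'X) * fpoly h.+2 n - fpoly h.+1 n.
Proof.
apply: polyrat_inj; first by rewrite coefB coefD coef_mul1X !coef_fpoly /=; ring.
rewrite derivB derivD derivM derivD derivX derivC !deriv_fpoly kpolyS -fpoly_kpoly.
rewrite -!mul_polyC -!(natr1 h.+1) -!(natr1 h) !polyCD; ring.
Qed.

Lemma fpoly0 h : fpoly h 0 = 1.
Proof.
apply/polyP=> j; rewrite coef_fpoly coef1; case: j => //= j.
by rewrite /kappa mulr0 mul0r.
Qed.

Lemma fpoly0S n : fpoly 0 n.+1 = 0.
Proof. by apply/polyP=> -[|j]; rewrite coef_fpoly coef0 ?mul0r. Qed.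

Lemma kpoly0 h : kpoly h 0 = 0.
Proof. by apply/polyP=> j; rewrite coef_kpoly coef0. Qed.

Lemma coef_exp1X n j : ((1 + 'X) ^+ n : {poly rat})`_j = 'C(n, j)%:R.
Proof.
elim: n j => [|n IHn] j; first by rewrite expr0 coef1 bin0n.
rewrite exprS coef_mul1X IHn; case: j => [|j]; first by rewrite !bin0 addr0.
by rewrite IHn binS natrD.
Qed.

(** [kpolyS] multiplied by a power of [1 + 'X] gives a recursion for an induction on [n], then on
    [h]. It does not reach [h = 0], so this row is computed directly, as is [n = 0], where
    [kpoly h 1 = 1]. *)
Lemma coef_exp1X_kpoly h n j :
  ((1 + 'X) ^+ h.+1 * kpoly h n.+1)`_j = ('C(n.+1 + h, j) * 'C(n + j, j))%:R.
Proof.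
elim: n h j => [|n IHn] h j.
  have -> : kpoly h 1 = 1.
    by apply/polyP=> i; rewrite coef_kpoly coef1 /kappa bin0n; case: i => [|i]; rewrite ?bin0.
  by rewrite mulr1 coef_exp1X add1n add0n binn muln1.
elim: h j => [|h IHh] j.
  rewrite expr1 coef_mul1X coef_kpoly /kappa; case: j => [|j]; first by rewrite !bin0 addr0.
  rewrite coef_kpoly /kappa add0n addn0.
  have j0 : j.+1%:R != 0 :> rat by rewrite pnatr_eq0.
  have -> : (n.+2 + j.+1 = (n + j + 2).+1)%N by lia.
  have -> : (n.+1 + j.+1 = n + j + 2)%N by lia.
  have -> : (n.+2 + j = n + j + 2)%N by lia.
  rewrite (binS n.+1) (binS (n + j + 2)).
  have h1 : j.+1%:R * 'C(n.+1, j.+1)%:R = (n%:R + 1 - j%:R) * 'C(n.+1, j)%:R :> rat.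
    rewrite -natrM mul_bin_left natrM; have [le|lt] := leqP j n.+1.
      by rewrite natrB // natr1.
    by rewrite bin_small // !mulr0.
  have h2 : j.+1%:R * 'C(n + j + 2, j.+1)%:R = (n%:R + 2) * 'C(n + j + 2, j)%:R :> rat.
    rewrite -natrM mul_bin_left natrM; have -> : (n + j + 2 - j = n + 2)%N by lia.
    by rewrite natrD.
  move: h1 h2; move: ('C(n.+1, j)) ('C(n.+1, j.+1)) => c d.
  move: ('C(n + j + 2, j)) ('C(n + j + 2, j.+1)) => D D1 h1 h2.
  rewrite !natrM !natrD; apply: (mulfI j0).
  have -> : D1%:R = (n%:R + 2) * D%:R / j.+1%:R :> rat by rewrite -h2 mulrC mulKf.
  have -> : d%:R = (n%:R + 1 - j%:R) * c%:R / j.+1%:R :> rat by rewrite -h1 mulrC mulKf.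
  by rewrite -natr1 in j0 *; field.
have -> : (1 + 'X) ^+ h.+2 * kpoly h.+1 n.+2 = (1 + 'X) * ((1 + 'X) ^+ h.+1 * kpoly h n.+2)
    + (1 + 'X) ^+ h.+3 * kpoly h.+2 n.+1 - (1 + 'X) ^+ h.+2 * kpoly h.+1 n.+1.
  by rewrite kpolyS !exprS; ring.
rewrite coefB coefD coef_mul1X !IHn !IHh; case: j => [|j]; first by rewrite !bin0; ring.
rewrite IHh.
have -> : (n.+2 + h.+1 = (n + h + 2).+1)%N by lia.
have -> : (n.+2 + h = n + h + 2)%N by lia.
have -> : (n.+1 + h.+2 = (n + h + 2).+1)%N by lia.
have -> : (n.+1 + h.+1 = n + h + 2)%N by lia.
have -> : (n.+1 + j = n + j.+1)%N by lia.
have -> : (n.+1 + j.+1 = (n + j.+1).+1)%N by lia.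
by rewrite (binS (n + h + 2)) (binS (n + j.+1)) !natrM !natrD; ring.
Qed.

(** * Generating functions of words *)

Definition words_gf (s : nat) (Q : pred (seq letter)) : {poly rat} :=
  \sum_(t : s.-tuple letter | Q t) 'X^(count_mem Au t).

Lemma words_gf0 Q : words_gf 0 Q = (Q [::])%:R.
Proof.
rewrite /words_gf big_mkcond (big_pred1 [tuple]) => [|t]; last by rewrite [t]tuple0 /=; apply/esym/eqP; apply: val_inj.
by rewrite /= expr0; case: (Q _).
Qed.

Lemma eq_words_gf s Q1 Q2 : Q1 =1 Q2 -> words_gf s Q1 = words_gf s Q2.
Proof. by move=> e; apply: eq_bigl => t; apply: e. Qed.

Lemma words_gf_eq0 s Q : (forall w, size w = s -> ~~ Q w) -> words_gf s Q = 0.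
Proof.
by move=> h; apply: big1 => t Qt; have := h t (size_tuple t); rewrite Qt.
Qed.

Lemma big_letter (F : letter -> {poly rat}) :
  \sum_l F l = F Dn + F Bu + F Au + F Pu.
Proof.
rewrite (bigD1 Dn) // (bigD1 Bu) // (bigD1 Au) //= (bigD1 Pu) //= big1 ?addr0 ?addrA //.
by case=> [[[]|]|].
Qed.

Lemma words_gfS_sum s Q : words_gf s.+1 Q =
  \sum_l 'X^(l == Au) * words_gf s (fun w => Q (l :: w)).
Proof.
pose cons' (p : letter * s.-tuple letter) := [tuple of p.1 :: p.2].
rewrite /words_gf (reindex cons') /=.
  under [RHS]eq_bigr => l _ do rewrite big_distrr /= big_mkcond.
  rewrite pair_bigA big_mkcond; apply: eq_bigr => -[l t] _ /=.
  by case: (Q _); rewrite // exprD.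
exists (fun t : s.+1.-tuple letter => (thead t, [tuple of behead t])) => [[l t]|t] _.
  by congr pair; apply: val_inj.
by rewrite /cons' -tuple_eta.
Qed.

Lemma words_gfS s Q : words_gf s.+1 Q =
  words_gf s (fun w => Q (Dn :: w)) + words_gf s (fun w => Q (Bu :: w)) +
  'X * words_gf s (fun w => Q (Au :: w)) + words_gf s (fun w => Q (Pu :: w)).
Proof. by rewrite words_gfS_sum big_letter !mul1r expr1. Qed.

Lemma words_gfB s (Q R : pred (seq letter)) : words_gf s (predI Q (predC R)) =
  words_gf s Q - words_gf s (predI Q R).
Proof.
rewrite /words_gf [X in _ = X - _](bigID (fun t : s.-tuple letter => R t)) /=.
by rewrite addrAC subrr add0r.
Qed.

Definition starts (l : letter) (w : seq letter) := if w is l' :: _ then l' == l else false.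

Lemma words_gf_starts l s Q : words_gf s (predI Q (starts l)) =
  if s is s'.+1 then 'X^(l == Au) * words_gf s' (fun w => Q (l :: w)) else 0.
Proof.
case: s => [|s]; first by rewrite words_gf0 /= andbF.
rewrite words_gfS_sum (bigD1 l) //= big1 ?addr0 => [|l' ne].
  by congr (_ * _); apply: eq_words_gf => w; rewrite /= eqxx andbT.
by rewrite words_gf_eq0 ?mulr0 // => w _; rewrite /= (negPf ne) andbF.
Qed.

Lemma reaches0_size (o : pred letter) h w : reaches0 o h w ->
  size w = (h + 2 * count o w)%N.
Proof.
elim: w h => [|l w IHw] h /=; first by move/eqP->.
by case/andP=> h0 /IHw ->; rewrite /step; move: (count o w) {IHw} => n; case: (o l) => /=; lia.
Qed.

(** [z] records that height 1 has already been reached, which frees the distinguished mark, and [q]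
    is the number of letters [Pu]: the state needed for a recursion on the first letter. *)
Definition outer_word z q h : pred (seq letter) := fun w =>
  [&& reaches0 is_up h w, sorted no_bare_peak w, z || zoned is_up h w & count_mem Pu w == q].

Definition inner_word z q h : pred (seq letter) := fun w =>
  [&& reaches0 is_dn h w, sorted no_bare_peak_rev w, z || zoned is_dn h w & count_mem Pu w == q].

Lemma path_no_bare_peak l w : path no_bare_peak l w =
  (if l == Bu then ~~ starts Dn w else true) && sorted no_bare_peak w.
Proof. by case: w => [|l' w]; rewrite /= ?/(no_bare_peak _ _) /=; case: (l == Bu). Qed.

Lemma path_no_bare_peak_rev l w : path no_bare_peak_rev l w =
  (if l == Dn then ~~ starts Bu w else true) && sorted no_bare_peak_rev w.
Proof. by case: w => [|l' w]; rewrite /= ?/(no_bare_peak_rev _ _) /=; case: (l == Dn). Qed.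

(** The terms are the possible first letters: [Dn]; then [Bu] or [Au], of total weight [1 + 'X],
    minus the forbidden start [Bu Dn]; then [Pu]. At [h = 0] the word starts at height 1, so the
    zone is open. *)
Lemma outer_gfS z q h s (hz := z || (h == 0%N)) :
  words_gf s.+1 (outer_word z q h.+1) =
  words_gf s (outer_word hz q h) + (1 + 'X) * words_gf s (outer_word hz q h.+2)
  - (if s is s'.+1 then words_gf s' (outer_word hz q h.+1) else 0)
  + (if q is q'.+1 then hz%:R * words_gf s (outer_word true q' h.+2) else 0).
Proof.
have zE l w : z || zoned is_up h.+1 (l :: w) =
    hz || ((l != Pu) && zoned is_up (step is_up h.+1 l) w) by rewrite /= orbA.
rewrite words_gfS.
have -> : words_gf s (fun w => outer_word z q h.+1 (Dn :: w)) = words_gf s (outer_word hz q h).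
  apply: eq_words_gf => w; rewrite /outer_word zE /= path_no_bare_peak /=.
  by rewrite add0n.
have -> : words_gf s (fun w => outer_word z q h.+1 (Au :: w)) = words_gf s (outer_word hz q h.+2).
  apply: eq_words_gf => w; rewrite /outer_word zE /= path_no_bare_peak /=.
  by rewrite add0n.
have -> : words_gf s (fun w => outer_word z q h.+1 (Bu :: w)) =
    words_gf s (predI (outer_word hz q h.+2) (predC (starts Dn))).
  apply: eq_words_gf => w; rewrite /outer_word zE /= path_no_bare_peak /=.
  rewrite add0n; case: (starts _ _); rewrite ?andbF ?andbT //.
have -> : words_gf s (fun w => outer_word z q h.+1 (Pu :: w)) =
    if q is q'.+1 then hz%:R * words_gf s (outer_word true q' h.+2) else 0.
  case: q => [|q]; first by apply: words_gf_eq0 => w _; rewrite /outer_word /= !andbF.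
  case: (boolP hz) => hzT; last first.
    rewrite mul0r; apply: words_gf_eq0 => w _.
    by rewrite /outer_word zE (negPf hzT) /= !andbF.
  rewrite mul1r; apply: eq_words_gf => w; rewrite /outer_word zE hzT /= path_no_bare_peak /=.
  by rewrite add1n eqSS.
rewrite words_gfB words_gf_starts.
set A := words_gf s _; set B := words_gf s _; set C := (X in _ - X);
have -> : C = (if s is s'.+1 then words_gf s' (outer_word hz q h.+1) else 0).
  rewrite /C; case: (s) => // s'; rewrite mul1r; apply: eq_words_gf => w.
  rewrite /outer_word /= path_no_bare_peak /= add0n.
  by [].
by congr (_ + _); rewrite mulrDl mul1r -!addrA; congr (_ + (_ + _)); apply: addrC.
Qed.

(** Backwards reading of [outer_gfS]: the openings, with their weight [1 + 'X], now lower the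
    height, and the forbidden start is [Dn Bu]. *)
Lemma inner_gfS z q h s (hz := z || (h == 0%N)) :
  words_gf s.+1 (inner_word z q h.+1) =
  (1 + 'X) * words_gf s (inner_word hz q h) + words_gf s (inner_word hz q h.+2)
  - (if s is s'.+1 then words_gf s' (inner_word hz q h.+1) else 0)
  + (if q is q'.+1 then hz%:R * words_gf s (inner_word true q' h) else 0).
Proof.
have zE l w : z || zoned is_dn h.+1 (l :: w) =
    hz || ((l != Pu) && zoned is_dn (step is_dn h.+1 l) w) by rewrite /= orbA.
rewrite words_gfS.
have -> : words_gf s (fun w => inner_word z q h.+1 (Au :: w)) = words_gf s (inner_word hz q h).
  apply: eq_words_gf => w; rewrite /inner_word zE /= path_no_bare_peak_rev /=.
  by rewrite add0n.
have -> : words_gf s (fun w => inner_word z q h.+1 (Bu :: w)) = words_gf s (inner_word hz q h).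
  apply: eq_words_gf => w; rewrite /inner_word zE /= path_no_bare_peak_rev /=.
  by rewrite add0n.
have -> : words_gf s (fun w => inner_word z q h.+1 (Dn :: w)) =
    words_gf s (predI (inner_word hz q h.+2) (predC (starts Bu))).
  apply: eq_words_gf => w; rewrite /inner_word zE /= path_no_bare_peak_rev /=.
  rewrite add0n; case: (starts _ _); rewrite ?andbF ?andbT //.
have -> : words_gf s (fun w => inner_word z q h.+1 (Pu :: w)) =
    if q is q'.+1 then hz%:R * words_gf s (inner_word true q' h) else 0.
  case: q => [|q]; first by apply: words_gf_eq0 => w _; rewrite /inner_word /= !andbF.
  case: (boolP hz) => hzT; last first.
    rewrite mul0r; apply: words_gf_eq0 => w _.
    by rewrite /inner_word zE (negPf hzT) /= !andbF.
  rewrite mul1r; apply: eq_words_gf => w; rewrite /inner_word zE hzT /= path_no_bare_peak_rev /=.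
  by rewrite add1n eqSS.
rewrite words_gfB words_gf_starts.
set A := words_gf s _; set B := words_gf s _; set C := (X in _ - X);
have -> : C = (if s is s'.+1 then words_gf s' (inner_word hz q h.+1) else 0).
  rewrite /C; case: (s) => // s'; rewrite mul1r; apply: eq_words_gf => w.
  rewrite /inner_word /= path_no_bare_peak_rev /= add0n.
  by [].
by congr (_ + _); rewrite -[LHS]addrA addrC mulrDl mul1r !addrA.
Qed.

Lemma outer_gf_eq0 z q h s : (forall c, s <> h + 2 * c)%N ->
  words_gf s (outer_word z q h) = 0.
Proof.
move=> hs; apply: words_gf_eq0 => w sw; apply/negP => /and4P[/reaches0_size e _ _ _].
by case: (hs (count is_up w)); rewrite -sw.
Qed.

Lemma inner_gf_eq0 z q h s : (forall c, s <> h + 2 * c)%N ->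
  words_gf s (inner_word z q h) = 0.
Proof.
move=> hs; apply: words_gf_eq0 => w sw; apply/negP => /and4P[/reaches0_size e _ _ _].
by case: (hs (count is_dn w)); rewrite -sw.
Qed.

(** [Pu] carries no weight, so turning one [Au] into [Pu] acts as the derivative. Confined to the
    last of [h] similar descents, it gives the derivative divided by [h]. The proof is an induction
    on the length, both sides obeying the same recursion. *)
Lemma outer_gf s n h : s = (2 * n + h)%N ->
  [/\ forall z, words_gf s (outer_word z 0 h) = fpoly h n,
      words_gf s (outer_word true 1 h) = (fpoly h n)^`()
    & (0 < h)%N -> words_gf s (outer_word false 1 h) = kpoly h n].
Proof.
have [m] := ubnP s; elim: m => // m IHm in s n h *; rewrite ltnS => sm es.
case: h es => [|h] es.
  case: s es sm => [|s] es sm.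
    have -> : n = 0%N by lia.
    by rewrite fpoly0 derivC; split=> // [z|]; rewrite words_gf0 /outer_word /= ?orbT.
  case: n es => [|n] es; first by lia.
  have z0 z q : words_gf s.+1 (outer_word z q 0) = 0.
    by apply: words_gf_eq0 => -[|l w] //= _.
  by rewrite fpoly0S deriv0; split.
case: s es sm => [|s] es sm; first by lia.
have {}es : s = (2 * n + h)%N by lia.
have [A0 A1 A2] := IHm s n h sm es.
case: n es A0 A1 A2 => [|n] es A0 A1 A2.
  have B0 z q : words_gf s (outer_word z q h.+2) = 0 by apply: outer_gf_eq0 => d; lia.
  have C0 z q : (if s is s'.+1 then words_gf s' (outer_word z q h.+1) else 0) = 0.
    by case: (s) es => // s' es; apply: outer_gf_eq0 => d; lia.
  have R z q : words_gf s.+1 (outer_word z q h.+1) = words_gf s (outer_word (z || (h == 0%N)) q h).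
    by rewrite outer_gfS !B0 C0 mulr0 addr0 subr0; case: q => [|q]; rewrite ?B0 ?mulr0 addr0.
  rewrite !fpoly0 in A0 A1 *; split=> [z||_]; rewrite R //.
  by rewrite kpoly0; case: h A1 A2 {es IHm A0 B0 C0 R} => [|h] A1 A2; [rewrite A1 derivC | rewrite A2 // kpoly0].
have [||B0 B1 B2] := IHm s n h.+2; [lia | lia | ].
case: s es sm A0 A1 A2 B0 B1 B2 => [|s] es sm A0 A1 A2 B0 B1 B2; first by lia.
have [||C0 C1 C2] := IHm s n h.+1; [lia | lia | ].
split=> [z||_].
- by rewrite outer_gfS A0 B0 C0 fpolyS addr0.
- rewrite outer_gfS /= A1 B1 C1 B0 mul1r fpolyS derivB derivD derivM derivD derivX derivC.
  move: (fpoly h n.+1)^`() (fpoly h.+2 n)^`() (fpoly h.+2 n) (fpoly h.+1 n)^`() => p1 p2 p3 p4; ring.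
rewrite outer_gfS /=; case: h es sm A0 A1 A2 B0 B1 B2 C0 C1 C2 => [|h] es sm A0 A1 A2 B0 B1 B2 C0 C1 C2.
  rewrite /= A1 B1 C1 B0 mul1r !deriv_fpoly kpolyS -fpoly_kpoly.
  rewrite scale0r add0r scale1r -!mul_polyC; ring.
by rewrite /= A2 // B2 // C2 // mul0r addr0 [RHS]kpolyS.
Qed.

(** In an inner path the [h] openings that reach a new minimum are the trunk; each contributes a
    factor [1 + 'X]. *)
Definition gpoly h n : {poly rat} := (1 + 'X) ^+ h * fpoly h n.

Lemma gpolyS h n :
  gpoly h.+1 n.+1 = (1 + 'X) * gpoly h n.+1 + gpoly h.+2 n - gpoly h.+1 n.
Proof.
rewrite /gpoly fpolyS !exprS.
by move: (fpoly h n.+1) (fpoly h.+2 n) (fpoly h.+1 n) => p1 p2 p3; ring.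
Qed.

Lemma gpoly0 h : gpoly h 0 = (1 + 'X) ^+ h. Proof. by rewrite /gpoly fpoly0 mulr1. Qed.

(** The last descent now ends with a trunk opening, which may itself be [Pu]. Differentiating its
    factor [1 + 'X] gives the term in [fpoly] of the third clause, differentiating the rest gives
    the term in [kpoly]. *)
Lemma inner_gf s n h : s = (2 * n + h)%N ->
  [/\ forall z, words_gf s (inner_word z 0 h) = gpoly h n,
      words_gf s (inner_word true 1 h) = (gpoly h n)^`()
    & (0 < h)%N -> words_gf s (inner_word false 1 h) =
        (1 + 'X) ^+ h.-1 * (fpoly h n + (1 + 'X) * kpoly h n)].
Proof.
have [m] := ubnP s; elim: m => // m IHm in s n h *; rewrite ltnS => sm es.
case: h es => [|h] es.
  case: s es sm => [|s] es sm.
    have -> : n = 0%N by lia.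
    by rewrite gpoly0 expr0 derivC; split=> // [z|]; rewrite words_gf0 /inner_word /= ?orbT.
  case: n es => [|n] es; first by lia.
  have z0 z q : words_gf s.+1 (inner_word z q 0) = 0.
    by apply: words_gf_eq0 => -[|l w] //= _.
  by rewrite /gpoly fpoly0S mulr0 deriv0; split.
case: s es sm => [|s] es sm; first by lia.
have {}es : s = (2 * n + h)%N by lia.
have [A0 A1 A2] := IHm s n h sm es.
case: n es A0 A1 A2 => [|n] es A0 A1 A2.
  have B0 z q : words_gf s (inner_word z q h.+2) = 0 by apply: inner_gf_eq0 => d; lia.
  have C0 z q : (if s is s'.+1 then words_gf s' (inner_word z q h.+1) else 0) = 0.
    by case: (s) es => // s' es; apply: inner_gf_eq0 => d; lia.
  have R z q : words_gf s.+1 (inner_word z q h.+1) =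
      (1 + 'X) * words_gf s (inner_word (z || (h == 0%N)) q h) +
      (if q is q'.+1 then (z || (h == 0%N))%:R * words_gf s (inner_word true q' h) else 0).
    by rewrite inner_gfS !B0 C0 addr0 subr0.
  have D : (gpoly h.+1 0)^`() = (1 + 'X) * (gpoly h 0)^`() + gpoly h 0.
    by rewrite !gpoly0 exprS derivM derivD derivX derivC add0r mul1r addrC.
  split=> [z||_]; rewrite R.
  - by rewrite A0 addr0 !gpoly0 exprS.
  - by rewrite /= A1 A0 mul1r D.
  rewrite kpoly0 fpoly0 mulr0 addr0 mulr1 /=.
  case: h {es IHm B0 C0 R D} A0 A1 A2 => [|h] A0 A1 A2.
    by rewrite /= A1 A0 gpoly0 expr0 derivC mulr0 add0r mul1r.
  by rewrite /= A2 // mul0r addr0 kpoly0 fpoly0 mulr0 addr0 mulr1 exprS.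
have [||B0 B1 B2] := IHm s n h.+2; [lia | lia | ].
case: s es sm A0 A1 A2 B0 B1 B2 => [|s] es sm A0 A1 A2 B0 B1 B2; first by lia.
have [||C0 C1 C2] := IHm s n h.+1; [lia | lia | ].
have D : (gpoly h.+1 n.+1)^`() =
    (1 + 'X) * (gpoly h n.+1)^`() + (gpoly h.+2 n)^`() - (gpoly h.+1 n)^`() + gpoly h n.+1.
  rewrite gpolyS derivB derivD derivM derivD derivX derivC.
  move: (gpoly h n.+1)^`() (gpoly h n.+1) (gpoly h.+2 n)^`() (gpoly h.+1 n)^`() => p1 p2 p3 p4.
  ring.
split=> [z||_].
- by rewrite inner_gfS A0 B0 C0 gpolyS addr0.
- by rewrite inner_gfS /= A1 B1 C1 A0 mul1r D.
rewrite inner_gfS /=; case: h es sm D A0 A1 A2 B0 B1 B2 C0 C1 C2 => [|h] es sm D A0 A1 A2 B0 B1 B2 C0 C1 C2.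
  rewrite /= A1 B1 C1 A0 mul1r -D /gpoly expr1 derivM deriv_fpoly derivD derivX derivC.
  by rewrite scale1r expr0 mul1r add0r mul1r.
rewrite /= A2 // B2 // C2 // mul0r addr0 [fpoly _ n.+1 in RHS]fpolyS [kpoly _ n.+1 in RHS]kpolyS /= !exprS.
move: (fpoly _ _) (fpoly _ _) (fpoly _ _) (kpoly _ _) (kpoly _ _) (kpoly _ _) => p1 p2 p3 p4 p5 p6.
ring.
Qed.

Lemma coef_words_gfM s1 s2 (Q1 Q2 : pred (seq letter)) k :
  (words_gf s1 Q1 * words_gf s2 Q2)`_k =
  \sum_(u : s1.-tuple letter) \sum_(w : s2.-tuple letter)
    [&& Q1 u, Q2 w & count_mem Au u + count_mem Au w == k]%N%:R.
Proof.
rewrite /words_gf big_distrlr /= coef_sum big_mkcond; apply: eq_bigr => u _.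
case: (Q1 u) => /=; last by rewrite big1.
rewrite coef_sum big_mkcond; apply: eq_bigr => w _.
by case: (Q2 w) => //=; rewrite -exprD coefXn eq_sym.
Qed.

Lemma card_valid_words a' b' L k :
  #|[set p : a'.+1.-tuple letter * b'.+1.-tuple letter | valid_words L k p]|%:R =
  (words_gf a'.+1 (inner_word false 1 L) * words_gf b'.+1 (outer_word false 0 L) +
   words_gf a'.+1 (inner_word false 0 L) * words_gf b'.+1 (outer_word false 1 L))`_k :> rat.
Proof.
rewrite coefD !coef_words_gfM -big_split /= -sum1dep_card natr_sum big_mkcond /=.
rewrite -(pair_bigA _ (fun u w => if valid_words L k (u, w) then 1 else 0)) /=.
apply: eq_bigr => u _; rewrite -big_split; apply: eq_bigr => w _ /=.
rewrite /valid_words /inner_word /outer_word /=.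
case: (reaches0 is_dn L u) => //=; case: (reaches0 is_up L w); rewrite ?andbF ?addr0 //=.
case: (sorted _ u) => //=; case: (sorted _ w); rewrite ?andbF ?addr0 //=.
case: (zoned _ _ u) => //=; case: (zoned _ _ w); rewrite ?andbF ?addr0 //=.
(* A valid pair has its single [Pu] in exactly one of the two words. *)
case: (count_mem Pu u) => [|[|x]]; case: (count_mem Pu w) => [|[|y]] //=;
  by case: (_ == k); rewrite ?addr0 ?add0r.
Qed.

(** * Telescoping over the cycle length *)

Section Telescope.
Variables (a' b' m1 m2 k : nat).
Hypotheses (ea : a'.+1 = (2 * m1)%N) (eb : b'.+1 = (2 * m2)%N).

Definition valid_number (L : nat) : nat :=
  #|[set p : a'.+1.-tuple letter * b'.+1.-tuple letter | valid_words L k p]|.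

Definition tail_poly (l : nat) : {poly rat} :=
  (1 + 'X) ^+ (2 * l).+1 * (kpoly (2 * l) (m1 - l) * kpoly (2 * l) (m2 - l)).

(** By [fpoly_kpoly], [T_(l-1)] is [(1 + X)^(2l-1)] times the product of the factors [F + (1 + X) K]
    of the two faces. Subtracting [T_l] removes the term with two [K], in which both faces would
    bear the distinguished mark. *)
Lemma valid_number_even l : (0 < l)%N ->
  (valid_number (2 * l))%:R = (tail_poly l.-1 - tail_poly l)`_k :> rat.
Proof.
move=> l0; rewrite card_valid_words; apply: (congr1 (fun p : {poly rat} => p`_k)).
have [h1|h1] := leqP l m1; last first.
  rewrite !inner_gf_eq0 ?mul0r ?addr0; [|move=> c; lia..].
  rewrite /tail_poly; have -> : (m1 - l.-1 = 0)%N by lia.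
  have -> : (m1 - l = 0)%N by lia.
  by rewrite !kpoly0 !mul0r !mulr0 subrr.
have [h2|h2] := leqP l m2; last first.
  rewrite !outer_gf_eq0 ?mulr0 ?addr0; [|move=> c; lia..].
  rewrite /tail_poly; have -> : (m2 - l.-1 = 0)%N by lia.
  have -> : (m2 - l = 0)%N by lia.
  by rewrite !kpoly0 !mulr0 subrr.
have [|I0 _ I1] := @inner_gf a'.+1 (m1 - l) (2 * l); first by lia.
have [|O0 _ O1] := @outer_gf b'.+1 (m2 - l) (2 * l); first by lia.
rewrite I0 O0 I1 ?O1; [|lia|lia].
case: l l0 h1 h2 {I0 I1 O0 O1} => // l _ h1 h2; rewrite /tail_poly /gpoly.
have -> : (2 * l.+1 = (2 * l).+2)%N by lia.
have -> : (m1 - l.+1.-1 = (m1 - l.+1).+1)%N by rewrite /=; lia.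
have -> : (m2 - l.+1.-1 = (m2 - l.+1).+1)%N by rewrite /=; lia.
rewrite -!fpoly_kpoly /= !exprS.
move: (fpoly _ _) (fpoly _ _) (kpoly _ _) (kpoly _ _) => p1 p2 p3 p4; ring.
Qed.

(** The first contour has even length [2 m1], which has the parity of the height it descends
    from. *)
Lemma valid_number_odd l : valid_number (2 * l).+1 = 0%N.
Proof.
apply/eqP; rewrite -(eqr_nat rat) card_valid_words.
by rewrite !inner_gf_eq0 ?mul0r ?addr0 ?coef0 //; move=> c; lia.
Qed.

(** Even and odd lengths are added in pairs, up to [2 m1 + 1]. The remainder [T_m1] vanishes since
    [kpoly h 0 = 0]. *)
Lemma sum_valid_number c : (c < m1)%N ->
  (\sum_((2 * c.+1)%N <= L < a'.+2) valid_number L)%N%:R = (tail_poly c)`_k :> rat.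
Proof.
move=> cm; have key q : (c <= q)%N ->
    (\sum_((2 * c.+1)%N <= L < (2 * q.+1)%N) valid_number L)%N%:R =
    (tail_poly c - tail_poly q)`_k :> rat.
  elim: q => [|q IHq] cq.
    have -> : c = 0%N by lia.
    by rewrite big_geq // subrr coef0.
  have [e|ne] := eqVneq c q.+1; first by rewrite -e big_geq // subrr coef0.
  have {}cq : (c <= q)%N by lia.
  have -> : (2 * q.+2 = (2 * q.+1).+2)%N by lia.
  rewrite big_nat_recr /=; last by lia.
  rewrite big_nat_recr /=; last by lia.
  rewrite valid_number_odd addn0 natrD IHq // valid_number_even //= -coefD.
  by apply: (congr1 (fun p : {poly rat} => p`_k)); rewrite addrA subrK.
have := key m1 (ltnW cm); rewrite ea.
have -> : (2 * m1.+1 = (2 * m1).+2)%N by lia.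
rewrite big_nat_recr /=; last by lia.
rewrite valid_number_odd addn0 => ->.
by rewrite {2}/tail_poly subnn kpoly0 mul0r mulr0 subr0.
Qed.

(** The power of [1 + 'X] may go with either factor; given to the second face, it yields [q] there
    and leaves [p] for the first. *)
Lemma coef_tail_poly c : (c < m1)%N -> (c < m2)%N ->
  (tail_poly c)`_k = (\sum_(k1 < k.+1) p1 c k1 m1 * q1 c (k - k1) m2)%N%:R.
Proof.
move=> h1 h2; clear ea eb; rewrite /tail_poly mulrCA coefM natr_sum; apply: eq_bigr => i _.
rewrite natrM; congr (_ * _).
  rewrite coef_kpoly /kappa; have -> : (m1 - c = (m1 - c.+1).+1)%N by lia.
  by congr (_ * 'C(_, _))%N%:R; lia.
have -> : (m2 - c = (m2 - c.+1).+1)%N by lia.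
by rewrite coef_exp1X_kpoly /q1; congr ('C(_, _) * _)%N%:R; lia.
Qed.
End Telescope.

(** * Product formulas *)

Lemma q1E c k m : (c < m)%N -> (q1 c k m)%:R =
  1 / (k`!%:R ^+ 2) * \prod_(0 <= i < k) (m%:R ^+ 2 - (c%:R - i%:R) ^+ 2) :> rat.
Proof.
move=> cm; elim: k => [|k IHk]; first by rewrite /q1 !bin0 big_geq // fact0; field.
rewrite big_nat_recr //= mulrA factS.
have f0 : k`!%:R != 0 :> rat by rewrite pnatr_eq0 -lt0n fact_gt0.
have k0 : k.+1%:R != 0 :> rat by rewrite pnatr_eq0.
have -> : 1 / (k.+1 * k`!)%:R ^+ 2 * \prod_(0 <= i < k) (m%:R ^+ 2 - (c%:R - i%:R) ^+ 2) =
    (q1 c k m)%:R / k.+1%:R ^+ 2 :> rat.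
  by rewrite IHk natrM; move: (\prod_(0 <= i < k) _) => P; rewrite -natr1 in k0 *; field; rewrite f0 k0.
have e1 : 'C(m + c, k.+1)%:R = (m%:R + c%:R - k%:R) * 'C(m + c, k)%:R / k.+1%:R :> rat.
  apply: (mulIf k0); rewrite divfK // mulrC -natrM mul_bin_left natrM.
  have [le|lt] := leqP k (m + c); first by rewrite natrB // natrD.
  by rewrite bin_small // !mulr0.
have e2 : 'C(m - c.+1 + k.+1, k.+1)%:R =
    (m%:R - c%:R + k%:R) * 'C(m - c.+1 + k, k)%:R / k.+1%:R :> rat.
  apply: (mulIf k0); rewrite divfK // mulrC -natrM addnS -mul_bin_diag natrM /=.
  by congr (_ * _); rewrite -natrB ?(ltnW cm) // -natrD; congr _%:R; lia.
(* The two ratios combine as [(m + c - k)(m - c + k) = m^2 - (c - k)^2]. *)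
rewrite /q1 !natrM e1 e2.
move: ('C(m + c, k)%:R : rat) ('C(m - c.+1 + k, k)%:R : rat) => x y.
by rewrite -natr1 in k0 *; field.
Qed.

Lemma p1E c k m : (c < m)%N -> (p1 c k m)%:R =
  1 / (k`!%:R ^+ 2) * \prod_(1 <= i < k.+1) (m%:R ^+ 2 - (c%:R + i%:R) ^+ 2) :> rat.
Proof.
move=> cm; elim: k => [|k IHk]; first by rewrite /p1 !bin0 big_geq // fact0; field.
rewrite big_nat_recr //= mulrA factS.
have f0 : k`!%:R != 0 :> rat by rewrite pnatr_eq0 -lt0n fact_gt0.
have k0 : k.+1%:R != 0 :> rat by rewrite pnatr_eq0.
have -> : 1 / (k.+1 * k`!)%:R ^+ 2 * \prod_(1 <= i < k.+1) (m%:R ^+ 2 - (c%:R + i%:R) ^+ 2) =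
    (p1 c k m)%:R / k.+1%:R ^+ 2 :> rat.
  by rewrite IHk natrM; move: (\prod_(1 <= i < k.+1) _) => P; rewrite -natr1 in k0 *; field; rewrite f0 k0.
have e1 : 'C(m - c.+1, k.+1)%:R = (m%:R - c%:R - 1 - k%:R) * 'C(m - c.+1, k)%:R / k.+1%:R :> rat.
  apply: (mulIf k0); rewrite divfK // mulrC -natrM mul_bin_left natrM.
  have [le|lt] := leqP k (m - c.+1); last by rewrite bin_small // !mulr0.
  by congr (_ * _); rewrite natrB // natrB // -natr1; ring.
have e2 : 'C(m + c + k.+1, k.+1)%:R =
    (m%:R + c%:R + k%:R + 1) * 'C(m + c + k, k)%:R / k.+1%:R :> rat.
  apply: (mulIf k0); rewrite divfK // mulrC -natrM addnS -mul_bin_diag natrM /=.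
  by rewrite -natr1 !natrD.
(* Here [(m - c - 1 - k)(m + c + k + 1) = m^2 - (c + k + 1)^2]. *)
rewrite /p1 !natrM e1 e2.
move: ('C(m - c.+1, k)%:R : rat) ('C(m + c + k, k)%:R : rat) => x y.
by rewrite -natr1 in k0 *; field.
Qed.

End GeneratingFunctions.

Theorem proposition3p11 (k c m1 m2 : nat) (hm1 : c < m1) (hm2 : c < m2) :
  [/\ count_up_to_iso (counted_map c k m1 m2)
        (\sum_(k1 < k.+1) p1 c k1 m1 * q1 c (k - k1) m2),
      forall k2 : nat,
        ((q1 c k2 m2)%:R =
          1 / (k2`!%:R ^+ 2) *
            \prod_(0 <= i < k2) (m2%:R ^+ 2 - (c%:R - i%:R) ^+ 2) :> rat)%R
    & forall k1 : nat,
        ((p1 c k1 m1)%:R =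
          1 / (k1`!%:R ^+ 2) *
            \prod_(1 <= i < k1.+1) (m1%:R ^+ 2 - (c%:R + i%:R) ^+ 2) :> rat)%R].
Proof.
split=> [|k2|k1]; [|exact: q1E|exact: p1E].
have ea : (2 * m1).-1.+1 = 2 * m1 by lia.
have eb : (2 * m2).-1.+1 = 2 * m2 by lia.
have := count_codes k c ea eb; rewrite card_codes_sum //.
set n := (X in count_up_to_iso _ X); suff -> : n = \sum_(k1 < k.+1) p1 c k1 m1 * q1 c (k - k1) m2 by [].
apply/eqP; rewrite -(Num.Theory.eqr_nat rat) -(coef_tail_poly _ hm1 hm2).
by rewrite /n (sum_valid_number _ ea eb).
Qed.
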